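(* Let $v:I\subseteq\mathbb{R}\to\mathbb{R}$ be a solution of $v''(x)-2\sinh(2v(x))=0$ with energy $E=\tfrac12v'(x)^2-\cosh(2v(x))$, $E\neq0$; if $E<0$, $I$ is understood to be restricted to an interval on which $2E+e^{2v(x)}<0$. Let $g_0$ be the Euclidean metric of $\mathbb{R}^2$, let $\Sigma_v=(I\times\mathbb{R},e^{2v}g_0)$ and let $G(x)=\int_0^x\frac{dt}{2E+e^{2v(t)}}$. Then the map $\phi_E:\Sigma_v\to\mathbf{H}^3_1$ given by $$\phi_E(x,y)=\tfrac{1}{\sqrt{2E}}\Bigl(e^{v(x)}\cos(\sqrt{2E}\,y),\,-e^{v(x)}\sin(\sqrt{2E}\,y),\,-\sqrt{2E+e^{2v(x)}}\cos(\sqrt{2E}\,G(x)),\,-\sqrt{2E+e^{2v(x)}}\sin(\sqrt{2E}\,G(x))\Bigr)$$ if $E>0$, and $$\phi_E(x,y)=\tfrac{1}{\sqrt{-2E}}\Bigl(\sqrt{-2E-e^{2v(x)}}\sinh(\sqrt{-2E}\,G(x)),\,e^{v(x)}\sinh(\sqrt{-2E}\,y),\,e^{v(x)}\cosh(\sqrt{-2E}\,y),\,\sqrt{-2E-e^{2v(x)}}\cosh(\sqrt{-2E}\,G(x))\Bigr)$$ if $E<0$, is an isometric maximal immersion with associated Hopf differential $\Theta(z)=\tfrac12\,dz\otimes dz$, where $z=x+iy$. Moreover, all the surfaces $\Sigma_v$, except the one associated to the trivial solution $v(x)=0$, which is the hyperbolic cylinder, are not complete.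
   Context: Let $\mathbb{R}^4_2$ be $\mathbb{R}^4$ with the metric $\langle\!\langle u,v\rangle\!\rangle=u_1v_1+u_2v_2-u_3v_3-u_4v_4$. Anti-De Sitter space is $\mathbf{H}^3_1=\{p\in\mathbb{R}^4_2:\langle\!\langle p,p\rangle\!\rangle=-1\}$ with the induced Lorentzian metric. A spacelike immersion of an oriented surface into $\mathbf{H}^3_1$ is maximal if it has zero mean curvature. For a conformal maximal immersion $\phi$ with conformal parameter $z=x+iy$, let $N$ be the timelike unit normal vector field to $\phi$ in $\mathbf{H}^3_1$ such that $\{\phi_x,\phi_y,\phi,N\}$ is a positively oriented frame in $\mathbb{R}^4_2$; the Hopf differential is the holomorphic 2-differential $\Theta_\phi(z)=\langle\!\langle\phi_z,N_z\rangle\!\rangle\,dz\otimes dz$ (with the metric extended complex-bilinearly). The energy $E$ of a solution $v$ is constant. The hyperbolic cylinder, considered up to isometries of $\mathbf{H}^3_1$, is the complete spacelike maximal surface with vanishing Gauss curvature $\{p\in\mathbb{R}^4_2:\ p_1^2-p_3^2=p_2^2-p_4^2=-\tfrac12\}$, parametrized by $\tfrac{1}{\sqrt2}(\sinh a,\sinh b,\cosh a,\cosh b)$ with $(a,b)\in\mathbb{R}^2$.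
   Formalization: No single orientation of R^4_2 gives Θ = 1/2 for both formulas (for v=0, E=-1 the standard one gives -1/2); the normal N is taken positively oriented for the standard orientation if E>0 and for the opposite orientation if E<0. *)

(* Defs.v *)
From Stdlib Require Import Reals.
From Coquelicot Require Export Coquelicot.
Open Scope R_scope.

(* A map on an open subset of R^2 is a total map together with a domain
   [U : R -> R -> Prop].  Every condition is imposed on [U] only, and values
   outside [U] never influence the derivatives at points of [U]. *)

Notation R4 := (R * R * R * R)%type.

Definition form (u w : R4) : R :=
  let '(u1, u2, u3, u4) := u in
  let '(w1, w2, w3, w4) := w in
  u1 * w1 + u2 * w2 - u3 * w3 - u4 * w4.

Definition H31 (p : R4) : Prop := form p p = -1.

Definition det3 (a1 a2 a3 b1 b2 b3 c1 c2 c3 : R) : R :=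
  a1 * (b2 * c3 - b3 * c2) - a2 * (b1 * c3 - b3 * c1)
  + a3 * (b1 * c2 - b2 * c1).

Definition det4 (a b c d : R4) : R :=
  let '(a1, a2, a3, a4) := a in
  let '(b1, b2, b3, b4) := b in
  let '(c1, c2, c3, c4) := c in
  let '(d1, d2, d3, d4) := d in
  a1 * det3 b2 b3 b4 c2 c3 c4 d2 d3 d4
  - a2 * det3 b1 b3 b4 c1 c3 c4 d1 d3 d4
  + a3 * det3 b1 b2 b4 c1 c2 c4 d1 d2 d4
  - a4 * det3 b1 b2 b3 c1 c2 c3 d1 d2 d3.

(* The isometries of H^3_1 are the restrictions of the elements of O(2,2). *)
Definition H31_isometry (A : R4 -> R4) : Prop :=
  is_linear A /\ forall u w, form (A u) (A w) = form u w.

Definition pdx (f : R -> R -> R) (x y : R) : R := Derive (fun t => f t y) x.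
Definition pdy (f : R -> R -> R) (x y : R) : R := Derive (fun t => f x t) y.

Fixpoint Ck (k : nat) (U : R -> R -> Prop) (f : R -> R -> R) : Prop :=
  match k with
  | O => forall x y, U x y -> continuity_2d_pt f x y
  | S k =>
      (forall x y, U x y ->
         ex_derive (fun t => f t y) x /\ ex_derive (fun t => f x t) y)
      /\ Ck k U (pdx f) /\ Ck k U (pdy f)
  end.

Definition smooth (U : R -> R -> Prop) (f : R -> R -> R) : Prop :=
  forall k, Ck k U f.

Definition coord1 (F : R -> R -> R4) x y : R := let '(a, _, _, _) := F x y in a.
Definition coord2 (F : R -> R -> R4) x y : R := let '(_, a, _, _) := F x y in a.
Definition coord3 (F : R -> R -> R4) x y : R := let '(_, _, a, _) := F x y in a.
Definition coord4 (F : R -> R -> R4) x y : R := let '(_, _, _, a) := F x y in a.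

Definition smooth4 (U : R -> R -> Prop) (F : R -> R -> R4) : Prop :=
  smooth U (coord1 F) /\ smooth U (coord2 F) /\ smooth U (coord3 F) /\ smooth U (coord4 F).

Definition vdx (F : R -> R -> R4) (x y : R) : R4 :=
  (pdx (coord1 F) x y, pdx (coord2 F) x y, pdx (coord3 F) x y, pdx (coord4 F) x y).
Definition vdy (F : R -> R -> R4) (x y : R) : R4 :=
  (pdy (coord1 F) x y, pdy (coord2 F) x y, pdy (coord3 F) x y, pdy (coord4 F) x y).

Definition pushforward (F : R -> R -> R4) (x y : R) (u : R * R) : R4 :=
  plus (scal (fst u) (vdx F x y)) (scal (snd u) (vdy F x y)).

Definition metric := R -> R -> R * R -> R * R -> R.

Definition path_in (U : R -> R -> Prop) (p q : R * R) (a b : R -> R) : Prop :=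
  (forall t, 0 <= t <= 1 ->
     U (a t) (b t)
     /\ ex_derive a t /\ continuous (Derive a) t
     /\ ex_derive b t /\ continuous (Derive b) t)
  /\ (a 0, b 0) = p /\ (a 1, b 1) = q.

Definition path_length (g : metric) (a b : R -> R) : R :=
  RInt (fun t => sqrt (g (a t) (b t)
                         (Derive a t, Derive b t) (Derive a t, Derive b t))) 0 1.

(* The paths need not be regular, so that piecewise C^1 paths, once
   reparametrized to stop at their corners, give the same infimum. *)
Definition riem_dist (U : R -> R -> Prop) (g : metric) (p q : R * R) : Rbar :=
  Glb_Rbar (fun l => exists a b, path_in U p q a b /\ l = path_length g a b).

Definition complete_surface (U : R -> R -> Prop) (g : metric) : Prop :=
  forall s : nat -> R * R,
    (forall n, U (fst (s n)) (snd (s n))) ->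
    (forall eps, 0 < eps -> exists M : nat, forall n m : nat,
       (M <= n)%nat -> (M <= m)%nat -> Rbar_lt (riem_dist U g (s n) (s m)) eps) ->
    exists q : R * R, U (fst q) (snd q) /\
      forall eps, 0 < eps -> exists M : nat, forall n : nat,
        (M <= n)%nat -> Rbar_lt (riem_dist U g (s n) q) eps.

Definition spacelike_immersion (U : R -> R -> Prop) (phi : R -> R -> R4) : Prop :=
  smooth4 U phi
  /\ forall x y, U x y ->
       H31 (phi x y)
       /\ (forall u, pushforward phi x y u = zero -> u = zero)
       /\ (forall u, u <> zero ->
             0 < form (pushforward phi x y u) (pushforward phi x y u)).

Definition isometric (U : R -> R -> Prop) (g : metric) (phi : R -> R -> R4) : Prop :=
  forall x y, U x y -> forall u w,
    form (pushforward phi x y u) (pushforward phi x y w) = g x y u w.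

(* [o] selects the orientation of R^4_2: the standard one if [0 < o], the
   opposite one if [o < 0].  For a spacelike immersion [phi] into H^3_1, at most
   one [N] on [U] satisfies this. *)
Definition unit_normal (o : R) (U : R -> R -> Prop) (phi N : R -> R -> R4) : Prop :=
  smooth4 U N
  /\ forall x y, U x y ->
       form (N x y) (N x y) = -1
       /\ form (N x y) (phi x y) = 0
       /\ form (N x y) (vdx phi x y) = 0
       /\ form (N x y) (vdy phi x y) = 0
       /\ 0 < o * det4 (vdx phi x y) (vdy phi x y) (phi x y) (N x y).

(* Since [N] is orthogonal to [phi], the component along [N] of the covariant
   derivative of H^3_1 is that of the flat derivative of R^4_2. *)
Definition mean_curvature (phi N : R -> R -> R4) (x y : R) : R :=
  let g11 := form (vdx phi x y) (vdx phi x y) in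
  let g12 := form (vdx phi x y) (vdy phi x y) in
  let g22 := form (vdy phi x y) (vdy phi x y) in
  let h11 := form (vdx (vdx phi) x y) (N x y) in
  let h12 := form (vdx (vdy phi) x y) (N x y) in
  let h22 := form (vdy (vdy phi) x y) (N x y) in
  (h11 * g22 - 2 * h12 * g12 + h22 * g11) / (2 * (g11 * g22 - g12 ^ 2)).

Definition maximal_wrt (U : R -> R -> Prop) (phi N : R -> R -> R4) : Prop :=
  spacelike_immersion U phi
  /\ forall x y, U x y -> mean_curvature phi N x y = 0.

Notation C4 := (C * C * C * C)%type.

Definition formC (u w : C4) : C :=
  let '(u1, u2, u3, u4) := u in
  let '(w1, w2, w3, w4) := w in
  (u1 * w1 + u2 * w2 - u3 * w3 - u4 * w4)%C.

Definition pdz (f : R -> R -> R) (x y : R) : C :=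
  (RtoC (/ 2) * (RtoC (pdx f x y) - Ci * RtoC (pdy f x y)))%C.

Definition vdz (F : R -> R -> R4) (x y : R) : C4 :=
  (pdz (coord1 F) x y, pdz (coord2 F) x y, pdz (coord3 F) x y, pdz (coord4 F) x y).

(* The coefficient of dz (x) dz, for z = x + i y. *)
Definition hopf_coefficient (phi N : R -> R -> R4) (x y : R) : C :=
  formC (vdz phi x y) (vdz N x y).

Definition interval (a b : Rbar) (x : R) : Prop := Rbar_lt a x /\ Rbar_lt x b.

Definition sinh_gordon_solution (I : R -> Prop) (v : R -> R) : Prop :=
  forall x, I x ->
    ex_derive v x /\ ex_derive (Derive v) x
    /\ Derive (Derive v) x - 2 * sinh (2 * v x) = 0.

Definition energy (v : R -> R) (x : R) : R :=
  / 2 * Derive v x ^ 2 - cosh (2 * v x).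

Definition strip (I : R -> Prop) (x _ : R) : Prop := I x.

Definition sigma_metric (v : R -> R) : metric :=
  fun x _ u w => exp (2 * v x) * (fst u * fst w + snd u * snd w).

Definition Gint (E : R) (v : R -> R) (x : R) : R :=
  RInt (fun t => / (2 * E + exp (2 * v t))) 0 x.

Definition phi_pos (E : R) (v : R -> R) (x y : R) : R4 :=
  let k := sqrt (2 * E) in
  let r := exp (v x) in
  let s := sqrt (2 * E + exp (2 * v x)) in
  (/ k * (r * cos (k * y)),
   / k * (- r * sin (k * y)),
   / k * (- s * cos (k * Gint E v x)),
   / k * (- s * sin (k * Gint E v x))).

Definition phi_neg (E : R) (v : R -> R) (x y : R) : R4 :=
  let k := sqrt (- 2 * E) in
  let r := exp (v x) in
  let s := sqrt (- 2 * E - exp (2 * v x)) in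
  (/ k * (s * sinh (k * Gint E v x)),
   / k * (r * sinh (k * y)),
   / k * (r * cosh (k * y)),
   / k * (s * cosh (k * Gint E v x))).

(* For a fixed orientation of R^4_2 the Hopf coefficients of [phi_pos] and
   [phi_neg] have opposite signs (1/2 and -1/2 for the standard one), whence
   the orientation [sign E] in results that cover both. *)
Definition phiE (E : R) (v : R -> R) : R -> R -> R4 :=
  if Rlt_dec 0 E then phi_pos E v else phi_neg E v.

Definition hyperbolic_cylinder (p : R4) : Prop :=
  exists a b : R,
    p = (/ sqrt 2 * sinh a, / sqrt 2 * sinh b, / sqrt 2 * cosh a, / sqrt 2 * cosh b).

(* Main.v *)
Require Import Defs.
From Stdlib Require Import Reals Lra Lia List FunctionalExtensionality
  Ranalysis5 ClassicalEpsilon.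
From Coquelicot Require Import Coquelicot.
Open Scope R_scope.
Import ListNotations.

(** Write sg for the sign of E, k^2 = 2 sg E, r = e^v and s^2 = k^2 + sg r^2, so
    that 2E + e^(2v) = sg s^2.  The energy becomes the first-order equation
    v'^2 r^2 = sg r^2 s^2 + 1, the primitive satisfies G' = sg / s^2, and s' is
    sg r^2 v' / s.

    The two formulas for [phiE] are the same map in two systems of coordinates:
    (r c, r w, s C, s W) / k, where (c, w) and (C, W) are the cosine and the sine
    of k y and of k G(x), circular for E > 0 and hyperbolic for E < 0, in a space
    whose form is diag(sg, 1, -1, -sg).  [embed] permutes the coordinates, with
    signs, to return to R^4_2.  In the model an explicit N can be written down, and
    every scalar product and the determinant in the statement are rational functions
    of r, s, v' and the trigonometric values; [frame_identities] evaluates them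
    modulo the relations above.  The products of first derivatives suffice for the
    second fundamental form, because <phi_x, N> = 0 gives <phi_xx, N> = - <phi_x, N_x>
    ([conformal_mean_curvature]).  Smoothness needs no chain rule of higher order:
    all functions involved lie in the algebra generated by nine functions whose
    partial derivatives are again in it ([algebra_smooth]).

    For completeness, let W be a primitive of e^v.  The length of a curve is at least
    the variation of W along it, with equality on horizontal segments, so the
    surface is incomplete as soon as W is bounded on one side of a point of I
    ([incomplete_of_finite_length]).  If E > 0 then |v'| >= sqrt (2E), and in the
    direction in which v decreases e^v is integrable ([length_descending]).  If
    E < 0 then e^v <= k.  From a point with v <> 0, go in the direction in which v^2
    does not decrease: as (v^2)'' >= 8 v^2, after unit time |v'| is at least
    4 |v| of the starting point ([sinh_gordon_escape]), so the rest has length at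
    most k divided by that bound ([length_bounded_escape]).

    For v = 0 the surface is the Euclidean plane, G(x) = - x, and the immersion is
    the parametrization of the hyperbolic cylinder with its last two coordinates
    exchanged. *)

(** * Smoothness from algebras closed under partial derivatives *)

Definition open2 (U : R -> R -> Prop) : Prop :=
  forall x y, U x y -> locally_2d U x y.

(** Openness of U makes the partial derivatives at its points depend on the values
    in U only. *)
Lemma Ck_ext (U : R -> R -> Prop) (k : nat) (f g : R -> R -> R) :
  open2 U -> (forall x y, U x y -> f x y = g x y) -> Ck k U f -> Ck k U g.
Proof.
  intros HU; revert f g; induction k as [|k IH]; intros f g Hfg; simpl.
  - intros Hf x y Hxy.
    apply (continuity_2d_pt_ext_loc f); [|now apply Hf].
    apply locally_2d_impl with (2 := HU x y Hxy).
    apply locally_2d_forall; exact Hfg.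
  - assert (Hx : forall x y, U x y -> locally x (fun t => f t y = g t y)).
    { intros x y Hxy.
      apply (locally_2d_1d_const_y (fun u w => f u w = g u w)).
      apply locally_2d_impl with (2 := HU x y Hxy).
      apply locally_2d_forall; exact Hfg. }
    assert (Hy : forall x y, U x y -> locally y (fun t => f x t = g x t)).
    { intros x y Hxy.
      apply (locally_2d_1d_const_x (fun u w => f u w = g u w)).
      apply locally_2d_impl with (2 := HU x y Hxy).
      apply locally_2d_forall; exact Hfg. }
    intros [Hd [H1 H2]]; split; [|split].
    + intros x y Hxy; destruct (Hd x y Hxy) as [Da Db]; split.
      * now apply (ex_derive_ext_loc (fun t => f t y)); [apply Hx|].
      * now apply (ex_derive_ext_loc (fun t => f x t)); [apply Hy|].
    + apply (IH (pdx f)); [|exact H1].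
      intros x y Hxy; apply Derive_ext_loc; now apply Hx.
    + apply (IH (pdy f)); [|exact H2].
      intros x y Hxy; apply Derive_ext_loc; now apply Hy.
Qed.

Inductive algebra (B : list (R -> R -> R)) : (R -> R -> R) -> Prop :=
| algebra_gen f : In f B -> algebra B f
| algebra_const c : algebra B (fun _ _ => c)
| algebra_opp f : algebra B f -> algebra B (fun x y => - f x y)
| algebra_plus f g : algebra B f -> algebra B g -> algebra B (fun x y => f x y + g x y)
| algebra_mult f g : algebra B f -> algebra B g -> algebra B (fun x y => f x y * g x y).

Definition has_partials (U : R -> R -> Prop) (f fx fy : R -> R -> R) : Prop :=
  forall x y, U x y ->
    is_derive (fun t => f t y) x (fx x y) /\ is_derive (fun t => f x t) y (fy x y).

(** The property to be checked on generators so that the algebra they generate is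
    closed under partial derivatives. *)
Definition stable (U : R -> R -> Prop) (B : list (R -> R -> R)) (f : R -> R -> R) : Prop :=
  (forall x y, U x y -> continuity_2d_pt f x y)
  /\ exists fx fy, algebra B fx /\ algebra B fy /\ has_partials U f fx fy.

(** Sums and products inherit [stable] by the Leibniz rule, so each partial derivative
    of an element of the algebra is again, on U, an element of the algebra; the order
    of differentiability is then raised by induction. *)
Lemma algebra_smooth (U : R -> R -> Prop) (B : list (R -> R -> R)) :
  open2 U -> (forall f, In f B -> stable U B f) ->
  forall f, algebra B f -> smooth U f.
Proof.
  intros HU HB.
  assert (HC := fun f Hf => proj1 (HB f Hf)).
  assert (HD := fun f Hf => proj2 (HB f Hf)).
  assert (HC' : forall f, algebra B f -> forall x y, U x y -> continuity_2d_pt f x y).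
  { intros f Hf x y Hxy; induction Hf.
    - now apply HC.
    - apply continuity_2d_pt_const.
    - now apply continuity_2d_pt_opp.
    - now apply continuity_2d_pt_plus.
    - now apply continuity_2d_pt_mult. }
  assert (HD' : forall f, algebra B f ->
     exists fx fy, algebra B fx /\ algebra B fy /\ has_partials U f fx fy).
  { intros f Hf; induction Hf as [h Hh|c|h Hh IHf|f g Hf IHf Hg IHg|f g Hf IHf Hg IHg].
    - now apply HD.
    - exists (fun _ _ => 0), (fun _ _ => 0).
      split; [apply algebra_const|split; [apply algebra_const|]].
      intros x y _; split; apply (@is_derive_const R_AbsRing R_NormedModule).
    - destruct IHf as (fx & fy & Hx & Hy & Hd).
      exists (fun x y => - fx x y), (fun x y => - fy x y).
      split; [now apply algebra_opp|split; [now apply algebra_opp|]].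
      intros x y Hxy; destruct (Hd x y Hxy); split;
        now apply (@is_derive_opp R_AbsRing R_NormedModule).
    - destruct IHf as (fx & fy & Hx & Hy & Hd), IHg as (gx & gy & Kx & Ky & Kd).
      exists (fun x y => fx x y + gx x y), (fun x y => fy x y + gy x y).
      split; [now apply algebra_plus|split; [now apply algebra_plus|]].
      intros x y Hxy; destruct (Hd x y Hxy), (Kd x y Hxy); split;
        now apply (@is_derive_plus R_AbsRing R_NormedModule).
    - destruct IHf as (fx & fy & Hx & Hy & Hd), IHg as (gx & gy & Kx & Ky & Kd).
      exists (fun x y => fx x y * g x y + f x y * gx x y),
        (fun x y => fy x y * g x y + f x y * gy x y).
      split; [|split]; try (apply algebra_plus; now apply algebra_mult).
      intros x y Hxy; destruct (Hd x y Hxy), (Kd x y Hxy); split.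
      + now apply (Derive.is_derive_mult (fun t => f t y) (fun t => g t y)).
      + now apply (Derive.is_derive_mult (fun t => f x t) (fun t => g x t)). }
  intros f Hf k; revert f Hf; induction k as [|k IH]; intros f Hf; simpl.
  - now apply HC'.
  - destruct (HD' f Hf) as (fx & fy & Hx & Hy & Hd); split; [|split].
    + intros x y Hxy; destruct (Hd x y Hxy); split; eexists; eassumption.
    + apply (Ck_ext U k fx); [exact HU| |now apply IH].
      intros x y Hxy; symmetry; apply is_derive_unique; now apply Hd.
    + apply (Ck_ext U k fy); [exact HU| |now apply IH].
      intros x y Hxy; symmetry; apply is_derive_unique; now apply Hd.
Qed.

Lemma is_derive_continuity_pt (f : R -> R) (x l : R) :
  is_derive f x l -> continuity_pt f x.
Proof.
  intros H; apply derivable_continuous_pt; exists l; now apply is_derive_Reals.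
Qed.

Lemma stable_x B (I : R -> Prop) (f f' : R -> R) :
  (forall x, I x -> is_derive f x (f' x)) -> algebra B (fun x _ => f' x) ->
  stable (strip I) B (fun x _ => f x).
Proof.
  intros Hf HB; split.
  - intros x y Hx; apply continuity_1d_2d_pt_comp; [|apply continuity_2d_pt_id1].
    now apply (is_derive_continuity_pt f x (f' x)), Hf.
  - exists (fun x _ => f' x), (fun _ _ => 0).
    split; [exact HB|split; [apply algebra_const|]].
    intros x y Hx; split; [now apply Hf|].
    apply (@is_derive_const R_AbsRing R_NormedModule).
Qed.

Lemma stable_y B (U : R -> R -> Prop) (f f' : R -> R) :
  (forall y, is_derive f y (f' y)) -> algebra B (fun _ y => f' y) ->
  stable U B (fun _ y => f y).
Proof.
  intros Hf HB; split.
  - intros x y _; apply continuity_1d_2d_pt_comp; [|apply continuity_2d_pt_id2].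
    now apply (is_derive_continuity_pt f y (f' y)).
  - exists (fun _ _ => 0), (fun _ y => f' y).
    split; [apply algebra_const|split; [exact HB|]].
    intros x y Hx; split; [|now apply Hf].
    apply (@is_derive_const R_AbsRing R_NormedModule).
Qed.

(** * Circular and hyperbolic functions, and primitives *)

(** The cosine and sine of a space of curvature sg = 1 or -1: solutions of
    C' = - sg S and S' = C. *)
Definition gcos (sg u : R) : R := if Rlt_dec 0 sg then cos u else cosh u.
Definition gsin (sg u : R) : R := if Rlt_dec 0 sg then sin u else sinh u.

Lemma is_derive_sinh (x : R) : is_derive sinh x (cosh x).
Proof. apply is_derive_Reals, derivable_pt_lim_sinh. Qed.

Lemma is_derive_cosh (x : R) : is_derive cosh x (sinh x).
Proof. apply is_derive_Reals, derivable_pt_lim_cosh. Qed.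

Lemma is_derive_gcos (sg u : R) : sg = 1 \/ sg = -1 ->
  is_derive (gcos sg) u (- sg * gsin sg u).
Proof.
  unfold gcos, gsin; intros [-> | ->]; destruct (Rlt_dec 0 _) as [H|H]; try lra.
  - replace (- (1) * sin u) with (- sin u) by ring; apply is_derive_cos.
  - replace (- (-1) * sinh u) with (sinh u) by ring; apply is_derive_cosh.
Qed.

Lemma is_derive_gsin (sg u : R) : sg = 1 \/ sg = -1 ->
  is_derive (gsin sg) u (gcos sg u).
Proof.
  unfold gcos, gsin; intros [-> | ->]; destruct (Rlt_dec 0 _) as [H|H]; try lra.
  - apply is_derive_sin.
  - apply is_derive_sinh.
Qed.

Lemma gcos2_gsin2 (sg u : R) : sg = 1 \/ sg = -1 ->
  gcos sg u ^ 2 = 1 - sg * gsin sg u ^ 2.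
Proof.
  unfold gcos, gsin; intros [-> | ->]; destruct (Rlt_dec 0 _) as [H|H]; try lra.
  - generalize (sin2_cos2 u); unfold Rsqr; lra.
  - unfold cosh, sinh.
    assert (exp u * exp (- u) = 1) by (rewrite <- exp_plus, Rplus_opp_r; apply exp_0).
    nra.
Qed.

(** Lets derivation rules produce a derivative in their own form, to be compared
    afterwards with the expected one. *)
Lemma is_derive_eq (f : R -> R) (x l l' : R) :
  is_derive f x l -> l = l' -> is_derive f x l'.
Proof. now intros H <-. Qed.

Lemma is_derive_comp_R (f g : R -> R) (x df dg l : R) :
  is_derive f (g x) df -> is_derive g x dg -> l = dg * df ->
  is_derive (fun t => f (g t)) x l.
Proof. intros Hf Hg ->; exact (is_derive_comp f g x df dg Hf Hg). Qed.

Lemma nondecreasing_of_derive (f f' : R -> R) (S T : R) :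
  (forall t, S <= t <= T -> is_derive f t (f' t) /\ 0 <= f' t) -> S <= T -> f S <= f T.
Proof.
  intros Hf Hle; destruct (MVT_gen f S T f') as (c & Hc & Heq).
  - intros t; rewrite Rmin_left, Rmax_right by lra; intros Ht; apply Hf; lra.
  - intros t; rewrite Rmin_left, Rmax_right by lra; intros Ht.
    apply (is_derive_continuity_pt f t (f' t)), Hf; lra.
  - rewrite Rmin_left, Rmax_right in Hc by lra; destruct (Hf c Hc) as [_ K]; nra.
Qed.

Lemma interval_open (a b : Rbar) : open (interval a b).
Proof. apply open_and; [apply open_Rbar_gt|apply open_Rbar_lt]. Qed.

Lemma interval_between (a b : Rbar) (x y z : R) :
  interval a b x -> interval a b y -> x <= z <= y -> interval a b z.
Proof.
  intros [Ha _] [_ Hb] [Hxz Hzy]; split.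
  - now apply Rbar_lt_le_trans with (1 := Ha).
  - now apply Rbar_le_lt_trans with (2 := Hb).
Qed.

Lemma is_derive_primitive (a b : Rbar) (f : R -> R) (x0 x : R) :
  (forall t, interval a b t -> continuous f t) ->
  interval a b x0 -> interval a b x -> is_derive (RInt f x0) x (f x).
Proof.
  intros Hf H0 Hx.
  apply (is_derive_RInt f (RInt f x0) x0); [|now apply Hf].
  apply (filter_imp (interval a b)); [|now apply interval_open].
  intros y Hy; apply (@RInt_correct R_CompleteNormedModule),
    (@ex_RInt_continuous R_CompleteNormedModule).
  intros z Hz; apply Hf.
  destruct (Rle_dec x0 y) as [Hl|Hl].
  - rewrite Rmin_left, Rmax_right in Hz by lra; now apply (interval_between a b x0 y).
  - rewrite Rmin_right, Rmax_left in Hz by lra; now apply (interval_between a b y x0).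
Qed.

(** * The profile of a solution *)

Definition admissible (I : R -> Prop) (E : R) (v : R -> R) : Prop :=
  sinh_gordon_solution I v
  /\ (forall x, I x -> energy v x = E)
  /\ E <> 0
  /\ (E < 0 -> forall x, I x -> 2 * E + exp (2 * v x) < 0).

(** k = [freq E] and s = [radius2 E v]: the common frequency of the two trigonometric
    pairs, and k times the radius of the second orbit, e^v being k times that of the
    first. *)
Definition freq (E : R) : R := sqrt (2 * (sign E * E)).
Definition radius2 (E : R) (v : R -> R) (x : R) : R :=
  sqrt (sign E * (2 * E + exp (2 * v x))).

Lemma sqr_exp_double (t : R) : exp (2 * t) = exp t ^ 2.
Proof. replace (2 * t) with (t + t) by ring; rewrite exp_plus; ring. Qed.

Lemma sign_cases (E : R) : E <> 0 -> sign E = 1 \/ sign E = -1.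
Proof.
  intros H; destruct (Rlt_dec 0 E).
  - left; now apply sign_eq_1.
  - right; apply sign_eq_m1; lra.
Qed.

Lemma sinh_gordon_energy (I : R -> Prop) (E : R) (v : R -> R) (x : R) :
  admissible I E v -> I x ->
  Derive v x ^ 2 = 2 * E + exp (v x) ^ 2 + / exp (v x) ^ 2.
Proof.
  intros (_ & HE & _ & _) Hx; specialize (HE x Hx); unfold energy, cosh in HE.
  rewrite exp_Ropp, !sqr_exp_double in HE; lra.
Qed.

Lemma admissible_sign (I : R -> Prop) (E : R) (v : R -> R) (x : R) :
  admissible I E v -> I x -> 0 < sign E * (2 * E + exp (2 * v x)).
Proof.
  intros (_ & _ & H0 & Hn) Hx.
  assert (0 < exp (2 * v x)) by apply exp_pos.
  destruct (Rlt_dec 0 E) as [HE|HE].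
  - rewrite sign_eq_1; lra.
  - rewrite sign_eq_m1; [|lra]. assert (E < 0) as HE' by lra.
    specialize (Hn HE' x Hx); lra.
Qed.

Lemma freq_pos (E : R) : E <> 0 -> 0 < freq E.
Proof.
  intros H; apply sqrt_lt_R0.
  destruct (Rlt_dec 0 E); [rewrite sign_eq_1|rewrite sign_eq_m1]; lra.
Qed.

Lemma radius2_pos I E v x : admissible I E v -> I x -> 0 < radius2 E v x.
Proof. intros H Hx; apply sqrt_lt_R0; now apply (admissible_sign I). Qed.

Lemma radius2_sqr I E v x : admissible I E v -> I x ->
  radius2 E v x ^ 2 = freq E ^ 2 + sign E * exp (v x) ^ 2.
Proof.
  intros H Hx; unfold radius2, freq; rewrite !pow2_sqrt.
  - rewrite sqr_exp_double; ring.
  - destruct H as (_ & _ & H & _).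
    destruct (Rlt_dec 0 E); [rewrite sign_eq_1|rewrite sign_eq_m1]; lra.
  - apply Rlt_le; now apply (admissible_sign I).
Qed.

Lemma speed_sqr I E v x : admissible I E v -> I x ->
  Derive v x ^ 2 * exp (v x) ^ 2 = sign E * exp (v x) ^ 2 * radius2 E v x ^ 2 + 1.
Proof.
  intros H Hx; rewrite (radius2_sqr I), (sinh_gordon_energy I E) by assumption.
  unfold freq; rewrite pow2_sqrt.
  - assert (0 < exp (v x)) by apply exp_pos.
    assert (HE : E <> 0) by apply H.
    destruct (sign_cases E HE) as [-> | ->]; field; lra.
  - destruct H as (_ & _ & H & _).
    destruct (Rlt_dec 0 E); [rewrite sign_eq_1|rewrite sign_eq_m1]; lra.
Qed.

Lemma is_derive_v I E v x : admissible I E v -> I x -> is_derive v x (Derive v x).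
Proof. intros [H _] Hx; apply Derive_correct; now apply (H x). Qed.

Lemma is_derive_dv I E v x : admissible I E v -> I x ->
  is_derive (Derive v) x (2 * sinh (2 * v x)).
Proof.
  intros [H _] Hx; destruct (H x Hx) as (_ & H2 & H3).
  replace (2 * sinh (2 * v x)) with (Derive (Derive v) x) by lra.
  now apply Derive_correct.
Qed.

Lemma is_derive_dv_exp I E v x : admissible I E v -> I x ->
  is_derive (fun t => Derive v t) x (exp (v x) * exp (v x) + - (/ exp (v x) * / exp (v x))).
Proof.
  intros H Hx; eapply is_derive_eq; [now apply (is_derive_dv _ E v x H)|].
  unfold sinh; rewrite exp_Ropp, !sqr_exp_double; field.
  apply Rgt_not_eq, exp_pos.
Qed.

Lemma is_derive_exp_v I E v x : admissible I E v -> I x ->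
  is_derive (fun t => exp (v t)) x (Derive v x * exp (v x)).
Proof.
  intros H Hx; eapply is_derive_comp_R;
    [apply is_derive_exp|now apply (is_derive_v I E)|reflexivity].
Qed.

Lemma is_derive_radius2 I E v x : admissible I E v -> I x ->
  is_derive (radius2 E v) x (sign E * (exp (v x) * exp (v x)) * Derive v x * / radius2 E v x).
Proof.
  intros H Hx.
  assert (Hs := radius2_pos I E v x H Hx).
  replace (sign E * (exp (v x) * exp (v x)) * Derive v x * / radius2 E v x)
    with (sign E * (2 * Derive v x * exp (2 * v x)) / (2 * radius2 E v x)).
  - apply is_derive_sqrt; [|now apply (admissible_sign I)].
    apply is_derive_scal.
    replace (2 * Derive v x * exp (2 * v x)) with (0 + 2 * Derive v x * exp (2 * v x)) by ring.
    apply (@is_derive_plus R_AbsRing R_NormedModule);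
      [apply (@is_derive_const R_AbsRing R_NormedModule)|].
    eapply is_derive_comp_R; [apply is_derive_exp| |reflexivity].
    apply is_derive_scal; now apply (is_derive_v I E).
  - rewrite sqr_exp_double; field; lra.
Qed.

Lemma is_derive_Gint a b E v x : admissible (interval a b) E v ->
  interval a b 0 -> interval a b x ->
  is_derive (Gint E v) x (sign E * (/ radius2 E v x) ^ 2).
Proof.
  intros H H0 Hx.
  assert (Hnz : forall t, interval a b t -> 2 * E + exp (2 * v t) <> 0).
  { intros t Ht Heq; assert (K := admissible_sign _ _ _ t H Ht).
    rewrite Heq in K; lra. }
  replace (sign E * (/ radius2 E v x) ^ 2) with (/ (2 * E + exp (2 * v x))).
  - apply (is_derive_primitive a b (fun t => / (2 * E + exp (2 * v t)))); try assumption.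
    intros t Ht; apply (@ex_derive_continuous R_AbsRing R_NormedModule).
    assert (ex_derive v t) by (eexists; now apply (is_derive_v _ E v t H)).
    auto_derive; repeat split; try assumption; now apply Hnz.
  - assert (K := Hnz x Hx). assert (K2 := admissible_sign _ _ _ x H Hx).
    rewrite pow_inv; unfold radius2; rewrite pow2_sqrt by lra.
    destruct (sign_cases E) as [Hs|Hs]; [apply H| |]; rewrite Hs; field; lra.
Qed.

(** * The moving frame *)

(** The model coordinates are ordered so that one formula serves both signs of E:
    first the two that depend on y, then the two that depend on G(x), cosine before
    sine in each pair. *)
Definition embed (E : R) (p : R4) : R4 :=
  let '(p1, p2, p3, p4) := p in
  if Rlt_dec 0 E then (p1, - p2, - p3, - p4) else (p4, p2, p1, p3).

(** The pull-back of the form of R^4_2 by [embed E], with sg the sign of E. *)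
Definition frame_form (sg : R) (p q : R4) : R :=
  let '(p1, p2, p3, p4) := p in
  let '(q1, q2, q3, q4) := q in
  sg * (p1 * q1) + p2 * q2 - p3 * q3 - sg * (p4 * q4).

(** Below, d stands for v', (c, w) for the cosine and sine of k y and (C, W) for those
    of k G(x); r, s and k are as above.  With the rotating vectors e = (c, w, 0, 0),
    f = (0, 0, C, W) and f' = (0, 0, - sg W, C), the position is (r e + s f) / k and
    its x-derivative is (v' r e + s' f) / k + (sg / s) f'.  The vector orthogonal to
    these two and to (- sg w, c, 0, 0) is a multiple of e / r + sg f / s + sg k v' f' / s,
    and has norm -1 with the factor -1 / k or 1 / k.  The factor -1 / k is the one that
    gives the Hopf coefficient 1/2. *)
Definition position (k r s c w C W : R) : R4 :=
  (/ k * (r * c), / k * (r * w), / k * (s * C), / k * (s * W)).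
Definition position_x (sg k r s d c w C W : R) : R4 :=
  (/ k * (d * r * c), / k * (d * r * w),
   / k * (sg * (r * r) * d * / s * C) - / s * W,
   / k * (sg * (r * r) * d * / s * W) + sg * (/ s * C)).
Definition position_y (sg r c w : R) : R4 := (- (sg * (r * w)), r * c, 0, 0).
Definition normal (sg k r s d c w C W : R) : R4 :=
  (- (/ k * (/ r * c)), - (/ k * (/ r * w)),
   d * / s * W + - (/ k * (sg * (/ s * C))),
   - (/ k * (sg * (/ s * W)) + sg * (d * / s * C))).
(** Here dd is v'' = 2 sinh (2 v) = r^2 - r^-2. *)
Definition normal_x (sg k r s d c w C W : R) : R4 :=
  let dd := r * r - / r * / r in
  (/ k * (d * / r * c), / k * (d * / r * w),
   dd * / s * W + (sg - sg * (d ^ 2 * r ^ 2)) * / s ^ 3 * W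
     + (sg * k * d + r ^ 2 * d * / k) * / s ^ 3 * C,
   - (sg * (dd * / s * C)) + (d ^ 2 * r ^ 2 - 1) * / s ^ 3 * C
     + (r ^ 2 * d * / k + sg * k * d) * / s ^ 3 * W).
Definition normal_y (sg r c w : R) : R4 := (sg * (/ r * w), - (/ r * c), 0, 0).

(** The four relations between the variables rewrite c^2, C^2, k^2 and d^2 r^2, after
    which each identity is one between polynomials. *)
Lemma frame_identities (sg k r s d c w C W : R) :
 sg = 1 \/ sg = -1 -> 0 < k -> 0 < r -> 0 < s ->
 c ^ 2 = 1 - sg * w ^ 2 -> C ^ 2 = 1 - sg * W ^ 2 -> k ^ 2 = s ^ 2 - sg * r ^ 2 ->
 d ^ 2 * r ^ 2 = sg * r ^ 2 * s ^ 2 + 1 ->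
 let p := position k r s c w C W in
 let px := position_x sg k r s d c w C W in
 let py := position_y sg r c w in
 let n := normal sg k r s d c w C W in
 let nx := normal_x sg k r s d c w C W in
 let ny := normal_y sg r c w in
 frame_form sg p p = -1 /\ frame_form sg px px = r ^ 2 /\ frame_form sg px py = 0
 /\ frame_form sg py py = r ^ 2 /\ frame_form sg n n = -1 /\ frame_form sg n p = 0
 /\ frame_form sg n px = 0 /\ frame_form sg n py = 0 /\ frame_form sg px nx = 1
 /\ frame_form sg py ny = -1 /\ frame_form sg px ny = 0 /\ frame_form sg py nx = 0
 /\ det4 px py p n = - r ^ 2.
Proof.
  intros Hsg Hk Hr Hs Hc HC Hks Hd; cbv zeta.
  unfold position, position_x, position_y, normal, normal_x, normal_y, frame_form, det4, det3.
  destruct Hsg as [-> | ->]; repeat split; field_simplify_eq; try (repeat split; lra);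
  ring [Hc HC Hks Hd].
Qed.

(** * The immersion in the moving frame *)

Definition model (E : R) (v : R -> R) (x y : R) : R4 :=
  position (freq E) (exp (v x)) (radius2 E v x)
    (gcos (sign E) (freq E * y)) (gsin (sign E) (freq E * y))
    (gcos (sign E) (freq E * Gint E v x)) (gsin (sign E) (freq E * Gint E v x)).

Definition model_normal (E : R) (v : R -> R) (x y : R) : R4 :=
  normal (sign E) (freq E) (exp (v x)) (radius2 E v x) (Derive v x)
    (gcos (sign E) (freq E * y)) (gsin (sign E) (freq E * y))
    (gcos (sign E) (freq E * Gint E v x)) (gsin (sign E) (freq E * Gint E v x)).

Lemma phiE_model E v : E <> 0 -> phiE E v = fun x y => embed E (model E v x y).
Proof.
  intros HE; do 2 (apply functional_extensionality; intro).
  unfold phiE, embed, model, position, freq, radius2, gcos, gsin.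
  destruct (Rlt_dec 0 E) as [H|H].
  - rewrite sign_eq_1 by exact H; destruct (Rlt_dec 0 1); [|lra].
    unfold phi_pos; rewrite !Rmult_1_l; f_equal; [f_equal; [f_equal|]|]; ring.
  - rewrite sign_eq_m1 by lra; destruct (Rlt_dec 0 (-1)); [lra|].
    unfold phi_neg.
    replace (2 * (-1 * E)) with (- 2 * E) by ring.
    now replace (-1 * (2 * E + exp (2 * v x))) with (- 2 * E - exp (2 * v x)) by ring.
Qed.

Lemma form_embed E p q : E <> 0 -> form (embed E p) (embed E q) = frame_form (sign E) p q.
Proof.
  intros HE; destruct p as [[[p1 p2] p3] p4], q as [[[q1 q2] q3] q4].
  unfold embed, form, frame_form; destruct (Rlt_dec 0 E) as [H|H].
  - rewrite sign_eq_1 by exact H; ring.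
  - rewrite sign_eq_m1 by lra; ring.
Qed.

(** The determinant of [embed E] is opposite to the sign of E; this is why the
    orientation has to follow that sign for the Hopf coefficient to be 1/2 in both
    cases. *)
Lemma det4_embed E p q r s : E <> 0 ->
  det4 (embed E p) (embed E q) (embed E r) (embed E s) = - sign E * det4 p q r s.
Proof.
  intros HE; destruct p as [[[p1 p2] p3] p4], q as [[[q1 q2] q3] q4],
    r as [[[r1 r2] r3] r4], s as [[[s1 s2] s3] s4].
  unfold embed, det4, det3; destruct (Rlt_dec 0 E) as [H|H].
  - rewrite sign_eq_1 by exact H; ring.
  - rewrite sign_eq_m1 by lra; ring.
Qed.

Lemma vdx_embed E F x y : vdx (fun x y => embed E (F x y)) x y = embed E (vdx F x y).
Proof.
  unfold vdx, pdx, coord1, coord2, coord3, coord4, embed; destruct (Rlt_dec 0 E);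
    rewrite <- ?Derive_opp; repeat f_equal; apply functional_extensionality;
    intros t; now destruct (F t y) as [[[? ?] ?] ?].
Qed.

Lemma vdy_embed E F x y : vdy (fun x y => embed E (F x y)) x y = embed E (vdy F x y).
Proof.
  unfold vdy, pdy, coord1, coord2, coord3, coord4, embed; destruct (Rlt_dec 0 E);
    rewrite <- ?Derive_opp; repeat f_equal; apply functional_extensionality;
    intros t; now destruct (F x t) as [[[? ?] ?] ?].
Qed.

(** * Smoothness of the immersion and of its normal *)

(** The inverses of e^v and of s are generators because an algebra has no division;
    v itself occurs only through v' and e^v. *)
Definition generators (E : R) (v : R -> R) : list (R -> R -> R) :=
  [ (fun _ y => gcos (sign E) (freq E * y));
    (fun _ y => gsin (sign E) (freq E * y));
    (fun x _ => Derive v x);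
    (fun x _ => exp (v x));
    (fun x _ => / exp (v x));
    (fun x _ => radius2 E v x);
    (fun x _ => / radius2 E v x);
    (fun x _ => gcos (sign E) (freq E * Gint E v x));
    (fun x _ => gsin (sign E) (freq E * Gint E v x)) ].

(** Membership is found by syntactic comparison: unification of two distinct generators
    would unfold the real numbers. *)
Ltac in_list :=
  unfold generators;
  repeat match goal with
  | |- In ?f (?g :: _) => first [constr_eq f g; apply in_eq | apply in_cons]
  end.

Ltac in_algebra :=
  cbv beta;
  lazymatch goal with
  | |- algebra _ (fun _ _ => ?c) => exact (algebra_const _ c)
  | |- algebra ?B (fun x y => - @?f x y) =>
      refine (algebra_opp B f _); in_algebra
  | |- algebra ?B (fun x y => @?f x y + @?g x y) =>
      refine (algebra_plus B f g _ _); in_algebra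
  | |- algebra ?B (fun x y => @?f x y * @?g x y) =>
      refine (algebra_mult B f g _ _); in_algebra
  | _ => apply algebra_gen; in_list
  end.

Lemma is_derive_gcos_freq E y : E <> 0 ->
  is_derive (fun t => gcos (sign E) (freq E * t)) y
    (- (sign E * freq E * gsin (sign E) (freq E * y))).
Proof.
  intros H; apply (is_derive_comp_R (gcos (sign E)) (fun t => freq E * t) y
    (- sign E * gsin (sign E) (freq E * y)) (freq E)).
  - now apply is_derive_gcos, sign_cases.
  - auto_derive; [exact I|ring].
  - ring.
Qed.

Lemma is_derive_gsin_freq E y : E <> 0 ->
  is_derive (fun t => gsin (sign E) (freq E * t)) y
    (freq E * gcos (sign E) (freq E * y)).
Proof.
  intros H; apply (is_derive_comp_R (gsin (sign E)) (fun t => freq E * t) y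
    (gcos (sign E) (freq E * y)) (freq E)).
  - now apply is_derive_gsin, sign_cases.
  - auto_derive; [exact I|ring].
  - ring.
Qed.

Lemma is_derive_gcos_G a b E v x : admissible (interval a b) E v ->
  interval a b 0 -> interval a b x ->
  is_derive (fun t => gcos (sign E) (freq E * Gint E v t)) x
    (- (freq E * (/ radius2 E v x * / radius2 E v x) * gsin (sign E) (freq E * Gint E v x))).
Proof.
  intros H H0 Hx; assert (HE : E <> 0) by apply H.
  apply (is_derive_comp_R (fun u => gcos (sign E) (freq E * u)) (Gint E v)
    x _ _ _ (is_derive_gcos_freq E (Gint E v x) HE) (is_derive_Gint a b E v x H H0 Hx)).
  destruct (sign_cases E HE) as [-> | ->]; ring.
Qed.

Lemma is_derive_gsin_G a b E v x : admissible (interval a b) E v ->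
  interval a b 0 -> interval a b x ->
  is_derive (fun t => gsin (sign E) (freq E * Gint E v t)) x
    (sign E * freq E * (/ radius2 E v x * / radius2 E v x) * gcos (sign E) (freq E * Gint E v x)).
Proof.
  intros H H0 Hx; assert (HE : E <> 0) by apply H.
  apply (is_derive_comp_R (fun u => gsin (sign E) (freq E * u)) (Gint E v)
    x _ _ _ (is_derive_gsin_freq E (Gint E v x) HE) (is_derive_Gint a b E v x H H0 Hx)).
  ring.
Qed.

Lemma is_derive_inv_exp_v I E v x : admissible I E v -> I x ->
  is_derive (fun t => / exp (v t)) x (- (Derive v x * / exp (v x))).
Proof.
  intros H Hx; assert (0 < exp (v x)) by apply exp_pos.
  eapply is_derive_eq.
  - apply is_derive_inv; [now apply (is_derive_exp_v I E)|lra].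
  - cbv beta; field; lra.
Qed.

Lemma is_derive_inv_radius2 I E v x : admissible I E v -> I x ->
  is_derive (fun t => / radius2 E v t) x
    (- (sign E * (exp (v x) * exp (v x)) * Derive v x
        * (/ radius2 E v x * (/ radius2 E v x * / radius2 E v x)))).
Proof.
  intros H Hx; assert (0 < radius2 E v x) by now apply (radius2_pos I).
  eapply is_derive_eq.
  - apply is_derive_inv; [now apply (is_derive_radius2 I E)|lra].
  - cbv beta; field; lra.
Qed.

Lemma generators_stable a b E v f : admissible (interval a b) E v ->
  interval a b 0 -> In f (generators E v) ->
  stable (strip (interval a b)) (generators E v) f.
Proof.
  intros H H0 Hf; assert (HE : E <> 0) by apply H.
  destruct Hf as [<-|[<-|[<-|[<-|[<-|[<-|[<-|[<-|[<-|[]]]]]]]]]].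
  - eapply stable_y; [intros y; now apply is_derive_gcos_freq|in_algebra].
  - eapply stable_y; [intros y; now apply is_derive_gsin_freq|in_algebra].
  - eapply stable_x; [intros x Hx; now apply (is_derive_dv_exp _ E v x H)|in_algebra].
  - eapply stable_x; [intros x Hx; now apply (is_derive_exp_v _ E v x H)|in_algebra].
  - eapply stable_x; [intros x Hx; now apply (is_derive_inv_exp_v _ E v x H)|in_algebra].
  - eapply stable_x; [intros x Hx; now apply (is_derive_radius2 _ E v x H)|in_algebra].
  - eapply stable_x; [intros x Hx; now apply (is_derive_inv_radius2 _ E v x H)|in_algebra].
  - eapply stable_x; [intros x Hx; now apply (is_derive_gcos_G a b E v x H)|in_algebra].
  - eapply stable_x; [intros x Hx; now apply (is_derive_gsin_G a b E v x H)|in_algebra].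
Qed.

Definition algebra4 B (F : R -> R -> R4) : Prop :=
  algebra B (coord1 F) /\ algebra B (coord2 F)
  /\ algebra B (coord3 F) /\ algebra B (coord4 F).

Ltac by_coordinates :=
  let f := lazymatch goal with |- algebra _ ?f => f end in
  let g := eval cbv beta iota zeta delta [coord1 coord2 coord3 coord4 model model_normal
    position normal] in (fun x y => f x y) in
  lazymatch goal with |- algebra ?B _ => change (algebra B g) end; in_algebra.

Lemma model_algebra E v : algebra4 (generators E v) (model E v).
Proof. repeat split; by_coordinates. Qed.

Lemma model_normal_algebra E v : algebra4 (generators E v) (model_normal E v).
Proof. repeat split; by_coordinates. Qed.

Lemma coord_eta (F : R -> R -> R4) x y :
  F x y = (coord1 F x y, coord2 F x y, coord3 F x y, coord4 F x y).
Proof. unfold coord1, coord2, coord3, coord4; now destruct (F x y) as [[[? ?] ?] ?]. Qed.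

Lemma embed_algebra B E F : algebra4 B F -> algebra4 B (fun x y => embed E (F x y)).
Proof.
  intros (H1 & H2 & H3 & H4).
  replace (fun x y => embed E (F x y))
    with (fun x y => embed E (coord1 F x y, coord2 F x y, coord3 F x y, coord4 F x y))
    by (do 2 (apply functional_extensionality; intro); now rewrite <- coord_eta).
  unfold embed; destruct (Rlt_dec 0 E).
  - repeat split; [exact H1|exact (algebra_opp _ _ H2)|exact (algebra_opp _ _ H3)
      |exact (algebra_opp _ _ H4)].
  - repeat split; [exact H4|exact H2|exact H1|exact H3].
Qed.

(** * First derivatives of the immersion and of its normal *)

(** Differentiates sums and products, the other factors being differentiated by a
    hypothesis.  Values at x are compared instead of functions, whose binders may
    carry different presentations of the type of reals. *)
Ltac derive_by_rules :=
  cbv beta;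
  lazymatch goal with
  | |- is_derive (fun _ => ?c) ?x _ => exact (@is_derive_const R_AbsRing R_NormedModule c x)
  | |- is_derive (fun t => - @?f t) ?x _ =>
      refine (@is_derive_opp R_AbsRing R_NormedModule f x _ _); derive_by_rules
  | |- is_derive (fun t => @?f t + @?g t) ?x _ =>
      refine (@is_derive_plus R_AbsRing R_NormedModule f g x _ _ _ _); derive_by_rules
  | |- is_derive (fun t => @?f t * @?g t) ?x _ =>
      refine (Derive.is_derive_mult f g x _ _ _ _); derive_by_rules
  | |- is_derive ?f ?x _ =>
      let fx := eval cbv beta in (f x) in
      match goal with H : is_derive ?g x _ |- _ =>
        let gx := eval cbv beta in (g x) in constr_eq fx gx; exact H
      end
  end.

Ltac partial_derivative :=
  unfold pdx, pdy; apply is_derive_unique;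
  let f := lazymatch goal with |- is_derive ?f _ _ => f end in
  let g := eval cbv beta iota zeta delta [coord1 coord2 coord3 coord4 model model_normal
    position normal] in f in
  lazymatch goal with |- is_derive _ ?x ?l => change (is_derive g x l) end;
  eapply is_derive_eq; [derive_by_rules|];
  unfold plus, opp, zero; simpl.

Lemma vdx_model a b E v x y : admissible (interval a b) E v ->
  interval a b 0 -> interval a b x ->
  vdx (model E v) x y =
  position_x (sign E) (freq E) (exp (v x)) (radius2 E v x) (Derive v x)
    (gcos (sign E) (freq E * y)) (gsin (sign E) (freq E * y))
    (gcos (sign E) (freq E * Gint E v x)) (gsin (sign E) (freq E * Gint E v x)).
Proof.
  intros H H0 Hx; assert (HE : E <> 0) by apply H.
  assert (K1 := is_derive_exp_v _ E v x H Hx).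
  assert (K2 : is_derive (fun t => radius2 E v t) x _) by exact (is_derive_radius2 _ E v x H Hx).
  assert (K3 := is_derive_gcos_G a b E v x H H0 Hx).
  assert (K4 := is_derive_gsin_G a b E v x H H0 Hx).
  assert (P1 := freq_pos E HE); assert (P2 := radius2_pos _ E v x H Hx).
  unfold vdx, position_x; f_equal; [f_equal; [f_equal|]|];
  partial_derivative; field; lra.
Qed.

Lemma vdy_model E v x y : E <> 0 ->
  vdy (model E v) x y =
  position_y (sign E) (exp (v x))
    (gcos (sign E) (freq E * y)) (gsin (sign E) (freq E * y)).
Proof.
  intros HE.
  assert (K1 := is_derive_gcos_freq E y HE).
  assert (K2 := is_derive_gsin_freq E y HE).
  assert (P1 := freq_pos E HE).
  unfold vdy, position_y; f_equal; [f_equal; [f_equal|]|];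
  partial_derivative; field; lra.
Qed.

Lemma vdx_model_normal a b E v x y : admissible (interval a b) E v ->
  interval a b 0 -> interval a b x ->
  vdx (model_normal E v) x y =
  normal_x (sign E) (freq E) (exp (v x)) (radius2 E v x) (Derive v x)
    (gcos (sign E) (freq E * y)) (gsin (sign E) (freq E * y))
    (gcos (sign E) (freq E * Gint E v x)) (gsin (sign E) (freq E * Gint E v x)).
Proof.
  intros H H0 Hx; assert (HE : E <> 0) by apply H.
  assert (K1 := is_derive_dv_exp _ E v x H Hx).
  assert (K2 := is_derive_inv_exp_v _ E v x H Hx).
  assert (K3 := is_derive_inv_radius2 _ E v x H Hx).
  assert (K4 := is_derive_gcos_G a b E v x H H0 Hx).
  assert (K5 := is_derive_gsin_G a b E v x H H0 Hx).
  assert (P1 := freq_pos E HE); assert (P2 := radius2_pos _ E v x H Hx).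
  assert (P3 := exp_pos (v x)).
  unfold vdx, normal_x; f_equal; [f_equal; [f_equal|]|]; partial_derivative;
  destruct (sign_cases E HE) as [Hs|Hs]; rewrite ?Hs; field; lra.
Qed.

Lemma vdy_model_normal E v x y : E <> 0 ->
  vdy (model_normal E v) x y =
  normal_y (sign E) (exp (v x))
    (gcos (sign E) (freq E * y)) (gsin (sign E) (freq E * y)).
Proof.
  intros HE.
  assert (K1 := is_derive_gcos_freq E y HE).
  assert (K2 := is_derive_gsin_freq E y HE).
  assert (P1 := freq_pos E HE); assert (P3 := exp_pos (v x)).
  unfold vdy, normal_y; f_equal; [f_equal; [f_equal|]|];
  partial_derivative; field; lra.
Qed.

(** * Curvature of conformal immersions *)

(** When N is normal, the real part compares the diagonal entries of the second
    fundamental form, and the imaginary part is half its off-diagonal entry. *)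
Lemma hopf_coefficient_form phi N x y :
  hopf_coefficient phi N x y =
  ((form (vdx phi x y) (vdx N x y) - form (vdy phi x y) (vdy N x y)) / 4,
   - (form (vdx phi x y) (vdy N x y) + form (vdy phi x y) (vdx N x y)) / 4).
Proof.
  unfold hopf_coefficient, formC, vdz, pdz, form, vdx, vdy, Ci, RtoC.
  unfold Cminus, Cplus, Cmult, Copp; simpl; f_equal; field.
Qed.

Lemma form_pushforward F x y u w :
  form (pushforward F x y u) (pushforward F x y w) =
  fst u * fst w * form (vdx F x y) (vdx F x y)
  + (fst u * snd w + snd u * fst w) * form (vdx F x y) (vdy F x y)
  + snd u * snd w * form (vdy F x y) (vdy F x y).
Proof.
  unfold pushforward, form, vdx, vdy; cbv [plus scal]; simpl.
  cbv [plus scal mult]; simpl; cbv [mult]; simpl; ring.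
Qed.

Lemma form_sym p q : form p q = form q p.
Proof.
  destruct p as [[[p1 p2] p3] p4], q as [[[q1 q2] q3] q4]; unfold form; ring.
Qed.

Lemma is_derive_form (F1 F2 F3 F4 N1 N2 N3 N4 : R -> R) (t : R) :
  ex_derive F1 t -> ex_derive F2 t -> ex_derive F3 t -> ex_derive F4 t ->
  ex_derive N1 t -> ex_derive N2 t -> ex_derive N3 t -> ex_derive N4 t ->
  is_derive (fun u => form (F1 u, F2 u, F3 u, F4 u) (N1 u, N2 u, N3 u, N4 u)) t
    (form (Derive F1 t, Derive F2 t, Derive F3 t, Derive F4 t) (N1 t, N2 t, N3 t, N4 t)
     + form (F1 t, F2 t, F3 t, F4 t) (Derive N1 t, Derive N2 t, Derive N3 t, Derive N4 t)).
Proof.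
  intros F1d F2d F3d F4d N1d N2d N3d N4d.
  apply Derive_correct in F1d, F2d, F3d, F4d, N1d, N2d, N3d, N4d.
  unfold form, Rminus; eapply is_derive_eq; [derive_by_rules|].
  unfold plus, opp; simpl; ring.
Qed.

(** Differentiate <F, N> = 0.  Applied to F = phi_x, this turns second derivatives of
    phi into first derivatives of N. *)
Lemma form_vdx_orthogonal U F N x y : open2 U -> U x y ->
  smooth4 U F -> smooth4 U N ->
  (forall x y, U x y -> form (F x y) (N x y) = 0) ->
  form (vdx F x y) (N x y) = - form (F x y) (vdx N x y).
Proof.
  intros HU Hxy (F1 & F2 & F3 & F4) (N1 & N2 & N3 & N4) Horth.
  assert (ed : forall f, smooth U f -> ex_derive (fun t => f t y) x).
  { intros f Hf; exact (proj1 (proj1 (Hf 1%nat) x y Hxy)). }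
  assert (D := is_derive_form _ _ _ _ _ _ _ _ x
    (ed _ F1) (ed _ F2) (ed _ F3) (ed _ F4) (ed _ N1) (ed _ N2) (ed _ N3) (ed _ N4)).
  apply is_derive_unique in D.
  rewrite (Derive_ext_loc _ (fun _ => 0)), Derive_const in D.
  - cbv beta in D; rewrite <- (coord_eta F x y), <- (coord_eta N x y) in D.
    symmetry in D; rewrite Rplus_comm in D; exact (Rplus_opp_r_uniq _ _ D).
  - apply (locally_2d_1d_const_y
      (fun t y => form (coord1 F t y, coord2 F t y, coord3 F t y, coord4 F t y)
                       (coord1 N t y, coord2 N t y, coord3 N t y, coord4 N t y) = 0)).
    apply locally_2d_impl with (2 := HU x y Hxy), locally_2d_forall.
    intros u w Huw; rewrite <- !coord_eta; now apply Horth.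
Qed.

Lemma form_vdy_orthogonal U F N x y : open2 U -> U x y ->
  smooth4 U F -> smooth4 U N ->
  (forall x y, U x y -> form (F x y) (N x y) = 0) ->
  form (vdy F x y) (N x y) = - form (F x y) (vdy N x y).
Proof.
  intros HU Hxy (F1 & F2 & F3 & F4) (N1 & N2 & N3 & N4) Horth.
  assert (ed : forall f, smooth U f -> ex_derive (fun t => f x t) y).
  { intros f Hf; exact (proj2 (proj1 (Hf 1%nat) x y Hxy)). }
  assert (D := is_derive_form _ _ _ _ _ _ _ _ y
    (ed _ F1) (ed _ F2) (ed _ F3) (ed _ F4) (ed _ N1) (ed _ N2) (ed _ N3) (ed _ N4)).
  apply is_derive_unique in D.
  rewrite (Derive_ext_loc _ (fun _ => 0)), Derive_const in D.
  - cbv beta in D; rewrite <- (coord_eta F x y), <- (coord_eta N x y) in D.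
    symmetry in D; rewrite Rplus_comm in D; exact (Rplus_opp_r_uniq _ _ D).
  - apply (locally_2d_1d_const_x
      (fun x t => form (coord1 F x t, coord2 F x t, coord3 F x t, coord4 F x t)
                       (coord1 N x t, coord2 N x t, coord3 N x t, coord4 N x t) = 0)).
    apply locally_2d_impl with (2 := HU x y Hxy), locally_2d_forall.
    intros u w Huw; rewrite <- !coord_eta; now apply Horth.
Qed.

Lemma smooth4_vdx U F : smooth4 U F -> smooth4 U (vdx F).
Proof. intros (H1 & H2 & H3 & H4); repeat split; intros k;
  [apply (H1 (S k))|apply (H2 (S k))|apply (H3 (S k))|apply (H4 (S k))]. Qed.

Lemma smooth4_vdy U F : smooth4 U F -> smooth4 U (vdy F).
Proof. intros (H1 & H2 & H3 & H4); repeat split; intros k;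
  [apply (H1 (S k))|apply (H2 (S k))|apply (H3 (S k))|apply (H4 (S k))]. Qed.

(** In a conformal parametrization the mean curvature is proportional to
    <phi_xx, N> + <phi_yy, N>, which is minus the trace <phi_x, N_x> + <phi_y, N_y>. *)
Lemma conformal_mean_curvature o U F N x y r : open2 U -> U x y ->
  smooth4 U F -> unit_normal o U F N ->
  form (vdx F x y) (vdx F x y) = r -> form (vdx F x y) (vdy F x y) = 0 ->
  form (vdy F x y) (vdy F x y) = r ->
  form (vdx F x y) (vdx N x y) + form (vdy F x y) (vdy N x y) = 0 ->
  mean_curvature F N x y = 0.
Proof.
  intros HU Hxy HF [HN Hn] E1 E2 E3 Htr; unfold mean_curvature.
  rewrite (form_vdx_orthogonal U (vdx F) N), (form_vdy_orthogonal U (vdy F) N), E1, E2, E3;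
    auto using smooth4_vdx, smooth4_vdy.
  2, 3 : intros x' y' H'; rewrite form_sym; now apply Hn.
  replace (_ - _ + _) with (- r * (form (vdx F x y) (vdx N x y) + form (vdy F x y) (vdy N x y)))
    by ring.
  rewrite Htr; unfold Rdiv; ring.
Qed.

(** A map that induces a positive definite metric has injective differential. *)
Lemma isometric_spacelike U v F : smooth4 U F -> (forall x y, U x y -> H31 (F x y)) ->
  isometric U (sigma_metric v) F -> spacelike_immersion U F.
Proof.
  intros HF HH Hi; split; [exact HF|]; intros x y Hxy; split; [now apply HH|].
  assert (P := exp_pos (2 * v x)).
  assert (Hpos : forall u, u <> zero -> 0 < form (pushforward F x y u) (pushforward F x y u)).
  { intros [u1 u2] Hu; rewrite (Hi x y Hxy); unfold sigma_metric; simpl.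
    apply Rmult_lt_0_compat; [exact P|].
    destruct (Req_dec u1 0) as [-> | H1]; [|nra].
    destruct (Req_dec u2 0) as [-> | H2]; [|nra].
    now elim Hu. }
  split; [|exact Hpos].
  intros u Hu; destruct (Req_dec (fst u) 0) as [H1|H1], (Req_dec (snd u) 0) as [H2|H2].
  { destruct u; simpl in *; now rewrite H1, H2. }
  all: exfalso; assert (Hu' : u <> zero) by (intros ->; now (apply H1 || apply H2));
    specialize (Hpos u Hu'); rewrite Hu in Hpos;
    unfold form, zero in Hpos; simpl in Hpos; unfold zero in Hpos; simpl in Hpos; lra.
Qed.

(** * The immersion is maximal *)

Lemma strip_open a b : open2 (strip (interval a b)).
Proof.
  intros x y Hx; destruct (interval_open a b x Hx) as [eps He].
  exists eps; intros u w Hu _; now apply He.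
Qed.

Lemma phiE_maximal_immersion a b v E : admissible (interval a b) E v -> interval a b 0 ->
  isometric (strip (interval a b)) (sigma_metric v) (phiE E v)
  /\ exists N : R -> R -> R4,
       unit_normal (sign E) (strip (interval a b)) (phiE E v) N
       /\ maximal_wrt (strip (interval a b)) (phiE E v) N
       /\ (forall x y, strip (interval a b) x y ->
             hopf_coefficient (phiE E v) N x y = RtoC (1 / 2)).
Proof.
  intros H H0; assert (HE : E <> 0) by apply H.
  set (U := strip (interval a b)).
  set (N := fun x y => embed E (model_normal E v x y)).
  assert (HU : open2 U) by apply strip_open.
  assert (Hsmooth : forall F, algebra4 (generators E v) F -> smooth4 U F).
  { intros F HF; repeat split; apply (algebra_smooth U (generators E v)); try apply HF;
      try exact HU; intros f Hf; now apply generators_stable. }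
  assert (Hphi : smooth4 U (phiE E v)).
  { rewrite phiE_model by exact HE; apply Hsmooth, embed_algebra, model_algebra. }
  assert (HN : smooth4 U N) by apply Hsmooth, embed_algebra, model_normal_algebra.
  assert (Hfr : forall x y, U x y ->
    let p := phiE E v x y in let px := vdx (phiE E v) x y in
    let py := vdy (phiE E v) x y in let n := N x y in
    let nx := vdx N x y in let ny := vdy N x y in
    form p p = -1 /\ form px px = exp (v x) ^ 2 /\ form px py = 0
    /\ form py py = exp (v x) ^ 2 /\ form n n = -1 /\ form n p = 0
    /\ form n px = 0 /\ form n py = 0 /\ form px nx = 1
    /\ form py ny = -1 /\ form px ny = 0 /\ form py nx = 0
    /\ det4 px py p n = - sign E * - exp (v x) ^ 2).
  { intros x y Hx; cbv zeta; rewrite phiE_model by exact HE; unfold N.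
    rewrite !vdx_embed, !vdy_embed, !form_embed, det4_embed by exact HE.
    rewrite (vdx_model a b), (vdx_model_normal a b), vdy_model, vdy_model_normal by assumption.
    assert (K := frame_identities (sign E) (freq E) (exp (v x)) (radius2 E v x) (Derive v x)
      (gcos (sign E) (freq E * y)) (gsin (sign E) (freq E * y))
      (gcos (sign E) (freq E * Gint E v x)) (gsin (sign E) (freq E * Gint E v x))).
    cbv zeta in K.
    destruct K as (K1 & K2 & K3 & K4 & K5 & K6 & K7 & K8 & K9 & K10 & K11 & K12 & K13);
      [now apply sign_cases|now apply freq_pos|apply exp_pos
      |exact (radius2_pos (interval a b) E v x H Hx)
      |now apply gcos2_gsin2, sign_cases|now apply gcos2_gsin2, sign_cases
      |rewrite (radius2_sqr (interval a b) E v x H Hx); ring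
      |rewrite (speed_sqr (interval a b) E v x H Hx); ring|].
    unfold model, model_normal; rewrite K13; repeat split; assumption. }
  assert (Hiso : isometric U (sigma_metric v) (phiE E v)).
  { intros x y Hxy u w; destruct (Hfr x y Hxy) as (_ & K2 & K3 & K4 & _).
    rewrite form_pushforward, K2, K3, K4; unfold sigma_metric; rewrite sqr_exp_double; ring. }
  split; [exact Hiso|]; exists N.
  assert (Hn : unit_normal (sign E) U (phiE E v) N).
  { split; [exact HN|]; intros x y Hxy.
    destruct (Hfr x y Hxy) as (_ & _ & _ & _ & K5 & K6 & K7 & K8 & _ & _ & _ & _ & K13).
    repeat split; try assumption; rewrite K13.
    assert (P := exp_pos (v x)).
    destruct (sign_cases E HE) as [-> | ->]; nra. }
  split; [exact Hn|split; [split|]].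
  - apply (isometric_spacelike U v); [exact Hphi| |exact Hiso].
    intros x y Hxy; now apply Hfr.
  - intros x y Hxy;
      destruct (Hfr x y Hxy) as (_ & K2 & K3 & K4 & _ & _ & _ & _ & K9 & K10 & _ & _ & _).
    apply (conformal_mean_curvature (sign E) U _ _ _ _ (exp (v x) ^ 2)); try assumption.
    rewrite K9, K10; ring.
  - intros x y Hxy;
      destruct (Hfr x y Hxy) as (_ & _ & _ & _ & _ & _ & _ & _ & K9 & K10 & K11 & K12 & _).
    rewrite hopf_coefficient_form, K9, K10, K11, K12; unfold RtoC; f_equal; field.
Qed.

(** * Lengths in the metric of the surface *)

Lemma riem_dist_lt U g p q (eps : R) :
  Rbar_lt (riem_dist U g p q) eps <->
  exists a b, path_in U p q a b /\ path_length g a b < eps.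
Proof.
  unfold riem_dist.
  match goal with |- context [Glb_Rbar ?S] => set (P := S) end.
  destruct (Glb_Rbar_correct P) as [Hlb Hglb]; split.
  - intros Hlt.
    destruct (excluded_middle_informative
      (exists a b, path_in U p q a b /\ path_length g a b < eps)) as [K|K]; [exact K|].
    exfalso; apply (Rbar_lt_not_le _ _ Hlt), Hglb.
    intros l (a & b & Hab & ->); simpl; apply Rnot_lt_le; intros Hl; apply K.
    now exists a, b.
  - intros (a & b & Hab & Hl).
    apply (Rbar_le_lt_trans _ (path_length g a b)); [|exact Hl].
    apply Hlb; now exists a, b.
Qed.

Lemma continuous_comp_derivable (f g : R -> R) (x : R) :
  ex_derive f x -> continuous g (f x) -> continuous (fun t => g (f t)) x.
Proof.
  intros Hf Hg; apply (continuous_comp f g); [|exact Hg].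
  now apply (@ex_derive_continuous R_AbsRing R_NormedModule).
Qed.

Lemma abs_le_sqrt (x y : R) : x ^ 2 <= y -> Rabs x <= sqrt y.
Proof.
  intros H; rewrite <- (sqrt_Rsqr_abs x); apply sqrt_le_1_alt.
  unfold Rsqr; lra.
Qed.

(** The function c is the value along the path of a function on the surface whose
    gradient has norm at most 1, such as a primitive of e^v in the variable x. *)
Lemma path_length_ge (I : R -> Prop) (v : R -> R) p q a b (c c' : R -> R) :
  (forall x, I x -> continuous v x) -> path_in (strip I) p q a b ->
  (forall t, 0 <= t <= 1 -> is_derive c t (c' t) /\ continuous c' t
     /\ c' t ^ 2 <= exp (v (a t)) ^ 2 * (Derive a t ^ 2 + Derive b t ^ 2)) ->
  Rabs (c 1 - c 0) <= path_length (sigma_metric v) a b.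
Proof.
  intros Hv [Hp _] Hc; unfold path_length.
  assert (B : forall t, Rmin 0 1 <= t <= Rmax 0 1 -> 0 <= t <= 1).
  { intros t; rewrite Rmin_left, Rmax_right; lra. }
  assert (HI : is_RInt c' 0 1 (c 1 - c 0)).
  { apply (is_RInt_derive c c'); intros t Ht; now apply Hc, B. }
  rewrite <- (is_RInt_unique _ _ _ _ HI).
  apply (Rle_trans _ (RInt (fun t => Rabs (c' t)) 0 1)).
  { apply abs_RInt_le; [lra|now exists (c 1 - c 0)]. }
  apply RInt_le; [lra| | |].
  - apply (@ex_RInt_continuous R_CompleteNormedModule); intros t Ht.
    apply continuous_Rabs_comp; now apply Hc, B.
  - apply (@ex_RInt_continuous R_CompleteNormedModule); intros t Ht.
    destruct (Hp t (B t Ht)) as (Ha & Da & Ca & Db & Cb).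
    apply continuous_sqrt_comp; unfold sigma_metric; simpl.
    apply (@continuous_mult R_UniformSpace R_AbsRing).
    + apply continuous_exp_comp.
      apply (@continuous_mult R_UniformSpace R_AbsRing); [apply continuous_const|].
      apply (continuous_comp_derivable a v); [exact Da|now apply Hv].
    + apply (@continuous_plus R_UniformSpace R_AbsRing R_NormedModule);
        now apply (@continuous_mult R_UniformSpace R_AbsRing).
  - intros t Ht; apply abs_le_sqrt; unfold sigma_metric; simpl fst; simpl snd.
    rewrite sqr_exp_double.
    destruct (Hc t) as (_ & _ & K); [lra|].
    replace (Derive a t * Derive a t + Derive b t * Derive b t)
      with (Derive a t ^ 2 + Derive b t ^ 2) by ring; exact K.
Qed.

Lemma sigma_dist_primitive (I : R -> Prop) (v W : R -> R) p q eps :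
  (forall x, I x -> continuous v x) ->
  (forall x, I x -> is_derive W x (exp (v x))) ->
  Rbar_lt (riem_dist (strip I) (sigma_metric v) p q) (Finite eps) ->
  Rabs (W (fst q) - W (fst p)) < eps.
Proof.
  intros Hv HW Hd; apply riem_dist_lt in Hd; destruct Hd as (a & b & Hab & Hl).
  apply Rle_lt_trans with (2 := Hl).
  destruct Hab as [Hp [H0 H1]]; rewrite <- H0, <- H1; simpl.
  apply (path_length_ge I v p q a b (fun t => W (a t)) (fun t => Derive a t * exp (v (a t))));
    [exact Hv|exact (conj Hp (conj H0 H1))|].
  intros t Ht; destruct (Hp t Ht) as (Ha & Da & Ca & Db & Cb); split; [|split].
  - apply (is_derive_comp_R W a t _ _ _ (HW _ Ha) (Derive_correct _ _ Da)); reflexivity.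
  - apply (@continuous_mult R_UniformSpace R_AbsRing); [exact Ca|].
    apply continuous_exp_comp, (continuous_comp_derivable a v); [exact Da|now apply Hv].
  - nra.
Qed.

(** A horizontal segment realizes the bound of [sigma_dist_primitive]. *)
Lemma horizontal_dist a b (v W : R -> R) (x x' y eps : R) :
  (forall x, interval a b x -> continuous v x) ->
  (forall x, interval a b x -> is_derive W x (exp (v x))) ->
  interval a b x -> interval a b x' -> Rabs (W x' - W x) < eps ->
  Rbar_lt (riem_dist (strip (interval a b)) (sigma_metric v) (x, y) (x', y)) (Finite eps).
Proof.
  intros Hv HW Hx Hx' He; apply riem_dist_lt.
  set (c := fun t => x + t * (x' - x)).
  assert (Dc : forall t, is_derive c t (x' - x)).
  { intros t; unfold c; auto_derive; [exact I|ring]. }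
  assert (Hc : forall t, 0 <= t <= 1 -> interval a b (c t)).
  { intros t Ht; unfold c; destruct (Rle_dec x x').
    - apply (interval_between a b x x'); [assumption|assumption|nra].
    - apply (interval_between a b x' x); [assumption|assumption|nra]. }
  assert (Cv : forall t, 0 <= t <= 1 -> continuous (fun t => exp (v (c t))) t).
  { intros t Ht; apply continuous_exp_comp, (continuous_comp_derivable c v);
      [eexists; apply Dc|now apply Hv, Hc]. }
  assert (EDc : Derive c = fun _ => x' - x).
  { apply functional_extensionality; intros t; now apply is_derive_unique. }
  exists c, (fun _ => y); split.
  - split; [|unfold c; split; f_equal; ring].
    intros t Ht; split; [now apply Hc|split; [now exists (x' - x)|]].
    rewrite EDc; split; [apply continuous_const|split; [apply ex_derive_const|]].
    replace (Derive (fun _ => y)) with (fun _ : R => 0); [apply continuous_const|].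
    apply functional_extensionality; intros u; symmetry; apply Derive_const.
  - apply Rle_lt_trans with (2 := He).
    unfold path_length, sigma_metric; simpl; rewrite EDc.
    assert (B : forall t, Rmin 0 1 <= t <= Rmax 0 1 -> 0 <= t <= 1).
    { intros t; rewrite Rmin_left, Rmax_right; lra. }
    assert (HI : is_RInt (fun t => (x' - x) * exp (v (c t))) 0 1 (W x' - W x)).
    { replace (W x' - W x) with (W (c 1) - W (c 0)) by (unfold c; repeat f_equal; ring).
      apply (is_RInt_derive (fun t => W (c t))); intros t Ht.
      - apply (is_derive_comp_R W c t _ _ _ (HW _ (Hc t (B t Ht))) (Dc t)); reflexivity.
      - apply (@continuous_mult R_UniformSpace R_AbsRing); [apply continuous_const|].
        now apply Cv, B. }
    assert (HI' := HI); apply (is_RInt_scal _ _ _ (sign (x' - x))) in HI'.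
    rewrite (RInt_ext _ (fun t => scal (sign (x' - x)) ((x' - x) * exp (v (c t))))).
    + apply Rle_trans with (scal (sign (x' - x)) (W x' - W x));
        [right; exact (is_RInt_unique _ _ _ _ HI')|].
      unfold scal; simpl; unfold mult; simpl.
      generalize (Rle_abs (W x' - W x)), (Rle_abs (- (W x' - W x))); rewrite Rabs_Ropp.
      unfold sign; destruct (total_order_T 0 (x' - x)) as [[?|?]|?];
        generalize (Rabs_pos (W x' - W x)); lra.
    + intros t _; rewrite Derive_const, sqr_exp_double.
      unfold scal; simpl; unfold mult; simpl.
      assert (P := exp_pos (v (c t))).
      transitivity (Rabs ((x' - x) * exp (v (c t)))).
      * rewrite <- sqrt_Rsqr_abs; f_equal; unfold Rsqr; ring.
      * rewrite Rabs_mult, (Rabs_pos_eq (exp _)) by lra.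
        unfold sign; destruct (total_order_T 0 (x' - x)) as [[?|e]|?].
        -- rewrite Rabs_pos_eq; lra.
        -- rewrite <- e, Rabs_R0; lra.
        -- rewrite Rabs_left; lra.
Qed.

(** On a horizontal line the distance is the one between values of W, so points whose
    values of W converge form a Cauchy sequence, and a limit of it would have the
    limit value. *)
Lemma incomplete_of_missing_limit a b (v W : R -> R) (s : nat -> R) l :
  (forall x, interval a b x -> continuous v x) ->
  (forall x, interval a b x -> is_derive W x (exp (v x))) ->
  (forall n, interval a b (s n)) -> Un_cv (fun n => W (s n)) l ->
  (forall x, interval a b x -> W x <> l) ->
  ~ complete_surface (strip (interval a b)) (sigma_metric v).
Proof.
  intros Hv HW Hs Hl Hmiss Hcomp.
  destruct (Hcomp (fun n => (s n, 0))) as (q & Hq & Hlim).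
  - exact Hs.
  - intros eps Heps; destruct (Hl (eps / 2)) as [M HM]; [lra|].
    exists M; intros n m Hn Hm; apply (horizontal_dist a b v W); try easy.
    assert (K1 := HM n Hn); assert (K2 := HM m Hm); unfold Rdist in K1, K2.
    replace (W (s m) - W (s n)) with ((W (s m) - l) + - (W (s n) - l)) by ring.
    apply Rle_lt_trans with (1 := Rabs_triang _ _); rewrite Rabs_Ropp; lra.
  - apply (Hmiss (fst q) Hq).
    apply (UL_sequence (fun n => W (s n))); [|exact Hl].
    intros eps Heps; destruct (Hlim eps Heps) as [M HM].
    exists M; intros n Hn; specialize (HM n Hn).
    apply (sigma_dist_primitive _ v W) in HM; [|exact Hv|exact HW].
    simpl in HM; unfold Rdist; now rewrite Rabs_minus_sym.
Qed.

(** The sign dl chooses a direction from x0.  The supremum of dl W in that direction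
    is finite, and not attained because W is strictly increasing on an open interval;
    points that approach it give a Cauchy sequence without limit. *)
Lemma incomplete_of_finite_length a b (v W : R -> R) (dl x0 C : R) :
  dl = 1 \/ dl = -1 ->
  (forall x, interval a b x -> continuous v x) ->
  (forall x, interval a b x -> is_derive W x (exp (v x))) ->
  interval a b x0 ->
  (forall T, 0 <= T -> interval a b (x0 + dl * T) ->
     dl * W (x0 + dl * T) <= dl * W x0 + C) ->
  ~ complete_surface (strip (interval a b)) (sigma_metric v).
Proof.
  intros Hdl Hv HW H0 HC.
  assert (Hmono : forall x x', interval a b x -> interval a b x' -> x < x' -> W x < W x').
  { intros x x' [Hx _] [_ Hx'] Hlt.
    apply (incr_function W a b (fun x => exp (v x))); try assumption.
    - intros u Hu Hu'; now apply HW.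
    - intros u _ _; apply exp_pos. }
  set (S := fun y => exists T, 0 <= T /\ interval a b (x0 + dl * T) /\ y = dl * W (x0 + dl * T)).
  destruct (completeness S) as [m [Hub Hlub]].
  - exists (dl * W x0 + C); intros y (T & HT & Hi & ->); now apply HC.
  - exists (dl * W x0), 0; rewrite Rmult_0_r, Rplus_0_r; repeat split; try apply H0; lra.
  - assert (Hs : forall n : nat, exists x, interval a b x
        /\ m - / (INR n + 1) < dl * W x <= m).
    { intros n; assert (P := RinvN_pos n).
      destruct (excluded_middle_informative (exists x, interval a b x
        /\ m - / (INR n + 1) < dl * W x <= m)) as [K|K]; [exact K|exfalso].
      assert (m <= m - / (INR n + 1)); [|lra].
      apply Hlub; intros y (T & HT & Hi & ->); apply Rnot_lt_le; intros Hlt; apply K.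
      exists (x0 + dl * T); split; [exact Hi|split; [exact Hlt|]].
      apply Hub; now exists T. }
    set (s := fun n => proj1_sig (constructive_indefinite_description _ (Hs n))).
    assert (Ps : forall n, interval a b (s n) /\ m - / (INR n + 1) < dl * W (s n) <= m).
    { intros n; exact (proj2_sig (constructive_indefinite_description _ (Hs n))). }
    apply (incomplete_of_missing_limit a b v W s (dl * m)); try assumption.
    + intros n; apply Ps.
    + intros eps Heps; destruct (archimed_cor1 eps Heps) as (M & HM & HM0).
      exists M; intros n Hn; destruct (Ps n) as [_ [K1 K2]]; unfold Rdist.
      assert (/ (INR n + 1) < eps).
      { apply Rle_lt_trans with (2 := HM), Rinv_le_contravar; [now apply lt_0_INR|].
        apply le_INR in Hn; lra. }
      replace (W (s n) - dl * m) with (dl * (dl * W (s n) - m))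
        by (destruct Hdl as [-> | ->]; ring).
      rewrite Rabs_mult.
      replace (Rabs dl) with 1
        by (destruct Hdl as [-> | ->]; [now rewrite Rabs_R1|rewrite Rabs_left; lra]).
      rewrite Rmult_1_l; apply Rabs_def1; lra.
    + intros x Hx Heq.
      destruct (interval_open a b x Hx) as [eps Hnear].
      assert (Hx' : interval a b (x + dl * (eps / 2))).
      { apply Hnear; assert (P := cond_pos eps).
        unfold ball; simpl; unfold AbsRing_ball, abs, minus, plus, opp; simpl.
        replace (x + dl * (eps / 2) + - x) with (dl * (eps / 2)) by ring.
        apply Rabs_def1; destruct Hdl as [-> | ->]; lra. }
      assert (P := cond_pos eps).
      (* a point beyond x, still in I, would exceed the supremum *)
      assert (Hbeyond : m < dl * W (x + dl * (eps / 2))).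
      { destruct Hdl as [-> | ->].
        - assert (K := Hmono x (x + 1 * (eps / 2)) Hx Hx'); lra.
        - assert (K := Hmono (x + -1 * (eps / 2)) x Hx' Hx); lra. }
      assert (Hle : dl * W (x + dl * (eps / 2)) <= m); [|lra].
      set (x1 := x + dl * (eps / 2)) in *.
      destruct (Rle_dec 0 (dl * (x1 - x0))) as [Hp|Hp].
      * apply Hub; exists (dl * (x1 - x0)).
        assert (E1 : x0 + dl * (dl * (x1 - x0)) = x1) by (destruct Hdl as [-> | ->]; ring).
        rewrite E1; repeat split; [exact Hp|apply Hx'|apply Hx'].
      * apply Rle_trans with (dl * W x0).
        -- destruct Hdl as [-> | ->].
           ++ assert (K := Hmono x1 x0 Hx' H0); lra.
           ++ assert (K := Hmono x0 x1 H0 Hx'); lra.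
        -- apply Hub; exists 0; rewrite Rmult_0_r, Rplus_0_r; repeat split; try apply H0; lra.
Qed.

(** * Nontrivial solutions *)

Lemma nonvanishing_negative (f : R -> R) (S T : R) :
  (forall t, S <= t <= T -> continuity_pt f t /\ f t <> 0) -> f S < 0 ->
  forall t, S <= t <= T -> f t < 0.
Proof.
  intros Hf HS t Ht; apply Rnot_le_lt; intros Hge.
  assert (Hpos : 0 < f t) by (destruct (Hf t Ht) as [_ K]; lra).
  assert (HSt : S < t) by (destruct (Req_dec S t) as [<-|]; lra).
  destruct (IVT_interv f S t) as (z & Hz & Hz0); try assumption.
  - intros u Hu; apply Hf; lra.
  - apply (Hf z); [lra|exact Hz0].
Qed.

(** Where w' <= - c, the length element e^w is at most - (e^w)' / c. *)
Lemma length_descending (c : R) (w w' W : R -> R) (S T : R) :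
  0 < c -> S <= T ->
  (forall t, S <= t <= T ->
     is_derive w t (w' t) /\ w' t <= - c /\ is_derive W t (exp (w t))) ->
  W T - W S <= exp (w S) / c.
Proof.
  intros Hc HST H.
  assert (K : - exp (w S) / c - W S <= - exp (w T) / c - W T).
  { apply (nondecreasing_of_derive (fun t => - exp (w t) / c - W t)
      (fun t => - (w' t * exp (w t)) / c - exp (w t))); [|exact HST].
    intros t Ht; destruct (H t Ht) as (D1 & Hw & D2); split.
    - assert (D3 := is_derive_comp_R exp w t _ _ _ (is_derive_exp (w t)) D1 eq_refl).
      unfold Rminus, Rdiv; eapply is_derive_eq.
      + apply (@is_derive_plus R_AbsRing R_NormedModule
          (fun t => - exp (w t) * / c) (fun t => - W t)).
        * apply (Derive.is_derive_mult (fun t => - exp (w t)) (fun _ => / c)).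
          -- apply (@is_derive_opp R_AbsRing R_NormedModule), D3.
          -- apply (@is_derive_const R_AbsRing R_NormedModule).
        * apply (@is_derive_opp R_AbsRing R_NormedModule), D2.
      + unfold plus, opp, zero; simpl; ring.
    - assert (P := exp_pos (w t)).
      replace (- (w' t * exp (w t)) / c - exp (w t)) with (exp (w t) * ((- w' t - c) / c))
        by (field; lra).
      apply Rmult_le_pos; [lra|]; apply Rdiv_le_0_compat; lra. }
  assert (0 < exp (w T) / c) by (apply Rdiv_lt_0_compat; [apply exp_pos|exact Hc]).
  unfold Rdiv in *; lra.
Qed.

(** The reverse path descends. *)
Lemma length_ascending (c : R) (w w' W : R -> R) (S T : R) :
  0 < c -> S <= T ->
  (forall t, S <= t <= T ->
     is_derive w t (w' t) /\ c <= w' t /\ is_derive W t (exp (w t))) ->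
  W T - W S <= exp (w T) / c.
Proof.
  intros Hc HST H.
  assert (K := length_descending c (fun t => w (- t)) (fun t => - w' (- t))
    (fun t => - W (- t)) (- T) (- S)).
  cbv beta in K; rewrite !Ropp_involutive in K.
  assert (- W S - - W T <= exp (w T) / c); [apply K|lra]; try lra.
  intros t Ht; destruct (H (- t)) as (D1 & Hw & D2); [lra|].
  assert (D0 : is_derive Ropp t (- (1))).
  { apply (@is_derive_opp R_AbsRing R_NormedModule (fun t => t) t 1).
    apply (@is_derive_id R_AbsRing). }
  split; [|split; [lra|]].
  - apply (is_derive_comp_R w Ropp t _ _ _ D1 D0); ring.
  - eapply is_derive_eq.
    + apply (@is_derive_opp R_AbsRing R_NormedModule (fun t => W (- t))).
      apply (is_derive_comp_R W Ropp t _ _ _ D2 D0); reflexivity.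
    + unfold opp; simpl; ring.
Qed.

Lemma sinh_ge (x : R) : 0 <= x -> x <= sinh x.
Proof.
  intros Hx.
  assert (K : sinh 0 - 0 <= sinh x - x).
  { apply (nondecreasing_of_derive (fun t => sinh t - t) (fun t => cosh t - 1)); [|exact Hx].
    intros t _; split.
    - apply (@is_derive_minus R_AbsRing R_NormedModule);
        [apply is_derive_sinh|apply (@is_derive_id R_AbsRing)].
    - unfold cosh; rewrite exp_Ropp; assert (P := exp_pos t).
      replace ((exp t + / exp t) / 2 - 1) with ((exp t - 1) ^ 2 * / (2 * exp t))
        by (field; lra).
      apply Rmult_le_pos; [apply pow2_ge_0|apply Rlt_le, Rinv_0_lt_compat; lra]. }
  rewrite sinh_0 in K; lra.
Qed.

Lemma sinh_odd_ge (x : R) : x ^ 2 <= x * sinh x.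
Proof.
  destruct (Rle_dec 0 x) as [H|H].
  - assert (K := sinh_ge x H); nra.
  - assert (K := sinh_ge (- x)).
    replace (sinh (- x)) with (- sinh x) in K; [nra|].
    unfold sinh; rewrite Ropp_involutive; field.
Qed.

(** With p = w w' and q = w^2, the equation and x sinh x >= x^2 give p' >= 4 q, hence
    in succession p >= 0, q >= q(0), p >= 4 q(0) t and q >= q(0) (1 + 4 t^2).  On the
    other hand w'^2 - 4 w^2 does not decrease, as its derivative
    4 w' (sinh (2 w) - 2 w) has the sign of p. *)
Lemma sinh_gordon_escape (w w' : R -> R) (T : R) :
  (forall t, 0 <= t <= T ->
     is_derive w t (w' t) /\ is_derive w' t (2 * sinh (2 * w t))) ->
  0 <= w 0 * w' 0 ->
  forall t, 0 <= t <= T -> 16 * w 0 ^ 2 * t ^ 2 <= w' t ^ 2.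
Proof.
  intros H H0.
  assert (Dp : forall t, 0 <= t <= T ->
    is_derive (fun t => w t * w' t) t (w' t * w' t + w t * (2 * sinh (2 * w t)))).
  { intros t Ht; destruct (H t Ht); now apply Derive.is_derive_mult. }
  assert (Hs : forall t, 4 * w t ^ 2 <= w' t * w' t + w t * (2 * sinh (2 * w t))).
  { intros t; assert (K := sinh_odd_ge (2 * w t)); nra. }
  assert (P1 : forall t, 0 <= t <= T -> 0 <= w t * w' t).
  { intros t Ht; apply Rle_trans with (1 := H0).
    apply (nondecreasing_of_derive (fun t => w t * w' t)
      (fun t => w' t * w' t + w t * (2 * sinh (2 * w t)))); [|lra].
    intros u Hu; split; [apply Dp; lra|].
    apply Rle_trans with (2 := Hs u); nra. }
  assert (P2 : forall t, 0 <= t <= T -> w 0 * w 0 <= w t * w t).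
  { intros t Ht.
    apply (nondecreasing_of_derive (fun t => w t * w t)
      (fun t => w' t * w t + w t * w' t)); [|lra].
    intros u Hu; split; [|assert (K := P1 u ltac:(lra)); lra].
    destruct (H u ltac:(lra)); now apply Derive.is_derive_mult. }
  assert (P3 : forall t, 0 <= t <= T -> 4 * (w 0 * w 0) * t <= w t * w' t).
  { intros t Ht; apply (Rplus_le_reg_r (- (4 * (w 0 * w 0) * t))).
    rewrite Rplus_opp_r; apply Rle_trans with (w 0 * w' 0 + - (4 * (w 0 * w 0) * 0)); [lra|].
    apply (nondecreasing_of_derive (fun t => w t * w' t + - (4 * (w 0 * w 0) * t))
      (fun t => (w' t * w' t + w t * (2 * sinh (2 * w t))) + - (4 * (w 0 * w 0)))); [|lra].
    intros u Hu; split.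
    - apply (@is_derive_plus R_AbsRing R_NormedModule); [apply Dp; lra|].
      apply (@is_derive_opp R_AbsRing R_NormedModule).
      auto_derive; [exact I|ring].
    - assert (K1 := Hs u); assert (K2 := P2 u ltac:(lra)); nra. }
  assert (P4 : forall t, 0 <= t <= T -> w 0 * w 0 + 4 * (w 0 * w 0) * t ^ 2 <= w t * w t).
  { intros t Ht; apply (Rplus_le_reg_r (- (4 * (w 0 * w 0) * t ^ 2))).
    apply Rle_trans with (w 0 * w 0 + - (4 * (w 0 * w 0) * 0 ^ 2)); [lra|].
    apply (nondecreasing_of_derive (fun t => w t * w t + - (4 * (w 0 * w 0) * t ^ 2))
      (fun t => (w' t * w t + w t * w' t) + - (8 * (w 0 * w 0) * t))); [|lra].
    intros u Hu; split; [|assert (K := P3 u ltac:(lra)); lra].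
    apply (@is_derive_plus R_AbsRing R_NormedModule).
    - destruct (H u ltac:(lra)); now apply Derive.is_derive_mult.
    - apply (@is_derive_opp R_AbsRing R_NormedModule).
      auto_derive; [exact I|ring]. }
  intros t Ht.
  assert (P5 : w' 0 * w' 0 + - (4 * (w 0 * w 0)) <= w' t * w' t + - (4 * (w t * w t))).
  { apply (nondecreasing_of_derive (fun t => w' t * w' t + - (4 * (w t * w t)))
      (fun t => (2 * sinh (2 * w t) * w' t + w' t * (2 * sinh (2 * w t)))
                + - (4 * (w' t * w t + w t * w' t)))); [|lra].
    intros u Hu; destruct (H u ltac:(lra)) as [D1 D2]; split.
    - apply (@is_derive_plus R_AbsRing R_NormedModule);
        [now apply Derive.is_derive_mult|].
      apply (@is_derive_opp R_AbsRing R_NormedModule), is_derive_scal.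
      now apply Derive.is_derive_mult.
    - assert (K1 := P1 u ltac:(lra)); assert (K2 := sinh_odd_ge (2 * w u)).
      destruct (Req_dec (w u) 0) as [E|E].
      + rewrite E, Rmult_0_r, sinh_0; lra.
      + apply (Rmult_le_reg_l (w u ^ 2)); [nra|rewrite Rmult_0_r].
        (* w^2 (w'^2 - 4 w^2)' = 2 (w w') (z sinh z - z^2) with z = 2 w *)
        replace (w u ^ 2 * _) with
          (2 * (w u * w' u) * (2 * w u * sinh (2 * w u) - (2 * w u) ^ 2)) by ring.
        nra. }
  assert (K := P4 t Ht); nra.
Qed.

Lemma affine_derive (f : R -> R) (x0 dl t l : R) :
  is_derive f (x0 + dl * t) l -> is_derive (fun t => f (x0 + dl * t)) t (dl * l).
Proof.
  intros H; apply (is_derive_comp_R f (fun t => x0 + dl * t) t l dl _ H); [|ring].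
  auto_derive; [exact I|ring].
Qed.

(** The bound on e^w controls the length during the first unit of time; afterwards
    |w'| >= 4 |w(0)|, so w is monotone with a definite speed, and e^w, bounded by k,
    is a monotone function whose variation controls the rest. *)
Lemma length_bounded_escape (w w' W : R -> R) (T k : R) :
  0 <= T ->
  (forall t, 0 <= t <= T ->
     is_derive w t (w' t) /\ is_derive w' t (2 * sinh (2 * w t))
     /\ is_derive W t (exp (w t)) /\ exp (w t) <= k) ->
  w 0 <> 0 -> 0 <= w 0 * w' 0 ->
  W T - W 0 <= k + k / (4 * Rabs (w 0)).
Proof.
  intros HT H Hw0 Hww.
  assert (Hc : 0 < 4 * Rabs (w 0)) by (assert (K := Rabs_pos_lt _ Hw0); lra).
  assert (Hk : 0 < k) by (apply Rlt_le_trans with (exp (w 0)); [apply exp_pos|apply H; lra]).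
  assert (Hkc : 0 < k / (4 * Rabs (w 0))) by now apply Rdiv_lt_0_compat.
  assert (Hslow : forall S, 0 <= S <= T -> W S - W 0 <= k * S).
  { intros S HS.
    assert (K : k * 0 + - W 0 <= k * S + - W S); [|lra].
    apply (nondecreasing_of_derive (fun t => k * t + - W t) (fun t => k + - exp (w t))); [|lra].
    intros t Ht; destruct (H t ltac:(lra)) as (_ & _ & D & B); split; [|lra].
    apply (@is_derive_plus R_AbsRing R_NormedModule).
    - auto_derive; [exact I|ring].
    - now apply (@is_derive_opp R_AbsRing R_NormedModule). }
  destruct (Rle_dec T 1) as [H1|H1].
  { assert (K := Hslow T ltac:(lra)); nra. }
  assert (K1 := Hslow 1 ltac:(lra)).
  assert (HE := sinh_gordon_escape w w' T
    (fun t Ht => conj (proj1 (H t Ht)) (proj1 (proj2 (H t Ht)))) Hww).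
  assert (Hsq : forall t, 1 <= t <= T -> (4 * Rabs (w 0)) ^ 2 <= w' t ^ 2).
  { intros t Ht; rewrite Rpow_mult_distr, RPow_abs, Rabs_pos_eq by nra.
    assert (0 <= w 0 ^ 2 * (t ^ 2 - 1)) by (apply Rmult_le_pos; nra).
    assert (K := HE t ltac:(lra)); lra. }
  assert (Hcont : forall t, 1 <= t <= T -> continuity_pt w' t).
  { intros t Ht; destruct (H t ltac:(lra)) as (_ & D & _).
    exact (is_derive_continuity_pt _ _ _ D). }
  assert (Hgoal : W T - W 1 <= k / (4 * Rabs (w 0))); [|lra].
  assert (Hfar : forall t, 1 <= t <= T -> w' t < 0 -> w' t <= - (4 * Rabs (w 0))).
  { intros t Ht Hneg; assert (K := Hsq t Ht); nra. }
  assert (Hfar' : forall t, 1 <= t <= T -> 0 < w' t -> 4 * Rabs (w 0) <= w' t).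
  { intros t Ht Hneg; assert (K := Hsq t Ht); nra. }
  assert (Hne : forall t, 1 <= t <= T -> w' t <> 0).
  { intros t Ht E; assert (K := Hsq t Ht); rewrite E in K; nra. }
  assert (Hdiv : forall t, 0 <= t <= T -> exp (w t) / (4 * Rabs (w 0)) <= k / (4 * Rabs (w 0))).
  { intros t Ht; apply Rmult_le_compat_r; [now apply Rlt_le, Rinv_0_lt_compat|now apply H]. }
  destruct (Rlt_dec (w' 1) 0) as [Hneg|Hpos].
  - apply Rle_trans with (2 := Hdiv 1 ltac:(lra)).
    apply (length_descending _ w w' W); [exact Hc|lra|].
    intros t Ht; destruct (H t ltac:(lra)) as (D1 & _ & D2 & _).
    split; [exact D1|split; [|exact D2]]; apply Hfar; [exact Ht|].
    apply (nonvanishing_negative w' 1 T); auto.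
  - apply Rle_trans with (2 := Hdiv T ltac:(lra)).
    apply (length_ascending _ w w' W); [exact Hc|lra|].
    intros t Ht; destruct (H t ltac:(lra)) as (D1 & _ & D2 & _).
    split; [exact D1|split; [|exact D2]]; apply Hfar'; [exact Ht|].
    assert (K := nonvanishing_negative (fun t => - w' t) 1 T).
    assert (- w' t < 0); [|lra]; apply K; [|assert (E := Hne 1 ltac:(lra)); lra|exact Ht].
    intros u Hu; split; [now apply continuity_pt_opp, Hcont|].
    specialize (Hne u Hu); lra.
Qed.

Lemma nontrivial_incomplete a b v E : admissible (interval a b) E v ->
  ~ (forall x, interval a b x -> v x = 0) ->
  ~ complete_surface (strip (interval a b)) (sigma_metric v).
Proof.
  intros H Hv0.
  destruct (excluded_middle_informative (exists x, interval a b x /\ v x <> 0)) as [K|K].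
  2:{ exfalso; apply Hv0; intros x Hx.
      destruct (Req_dec (v x) 0) as [|Hn]; [assumption|exfalso; apply K; now exists x]. }
  destruct K as (x0 & Hx0 & Hne).
  set (W := RInt (fun t => exp (v t)) x0).
  assert (Dv := fun x Hx => is_derive_v (interval a b) E v x H Hx).
  assert (Ddv := fun x Hx => is_derive_dv (interval a b) E v x H Hx).
  assert (Hcont : forall x, interval a b x -> continuous v x).
  { intros x Hx; apply (@ex_derive_continuous R_AbsRing R_NormedModule).
    eexists; now apply Dv. }
  assert (HW : forall x, interval a b x -> is_derive W x (exp (v x))).
  { intros x Hx; apply (is_derive_primitive a b (fun t => exp (v t))); try assumption.
    intros t Ht; now apply continuous_exp_comp, Hcont. }
  assert (Hseg : forall dl T t, interval a b (x0 + dl * T) -> dl = 1 \/ dl = -1 ->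
    0 <= t <= T -> interval a b (x0 + dl * t)).
  { intros dl T t HT [-> | ->] Ht.
    - apply (interval_between a b x0 (x0 + 1 * T)); [assumption|assumption|lra].
    - apply (interval_between a b (x0 + -1 * T) x0); [assumption|assumption|lra]. }
  assert (Hprof : forall dl T, interval a b (x0 + dl * T) -> dl = 1 \/ dl = -1 ->
    forall t, 0 <= t <= T ->
    is_derive (fun t => v (x0 + dl * t)) t (dl * Derive v (x0 + dl * t))
    /\ is_derive (fun t => dl * Derive v (x0 + dl * t)) t (2 * sinh (2 * v (x0 + dl * t)))
    /\ is_derive (fun t => dl * W (x0 + dl * t)) t (exp (v (x0 + dl * t)))).
  { intros dl T HT Hdl t Ht; assert (Hi := Hseg dl T t HT Hdl Ht).
    assert (Hsq : forall z, z = dl * (dl * z)) by (intros z; destruct Hdl as [-> | ->]; ring).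
    split; [|split].
    - now apply affine_derive, Dv.
    - rewrite (Hsq (2 * sinh _)); now apply is_derive_scal, affine_derive, Ddv.
    - rewrite (Hsq (exp _)); now apply is_derive_scal, affine_derive, HW. }
  destruct (Rlt_dec 0 E) as [HE|HE].
  (* the direction in which v decreases: v' never vanishes, so it does so throughout *)
  - set (dl := if Rlt_dec 0 (Derive v x0) then -1 else 1).
    assert (Hdl : dl = 1 \/ dl = -1) by (unfold dl; destruct (Rlt_dec _ _); auto).
    assert (Hspeed : forall x, interval a b x -> sqrt (2 * E) ^ 2 < Derive v x ^ 2).
    { intros x Hx; rewrite pow2_sqrt, (sinh_gordon_energy (interval a b) E v x H Hx) by lra.
      assert (P := pow_lt _ 2 (exp_pos (v x))); assert (Q := Rinv_0_lt_compat _ P); lra. }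
    assert (Hc : 0 < sqrt (2 * E)) by (apply sqrt_lt_R0; lra).
    apply (incomplete_of_finite_length a b v W dl x0 (exp (v (x0 + dl * 0)) / sqrt (2 * E)));
      try assumption.
    intros T HT Hi.
    assert (Hneg : forall t, 0 <= t <= T -> dl * Derive v (x0 + dl * t) < 0).
    { apply (nonvanishing_negative (fun t => dl * Derive v (x0 + dl * t)) 0 T).
      - intros t Ht; destruct (Hprof dl T Hi Hdl t Ht) as (_ & D & _); split.
        + exact (is_derive_continuity_pt _ _ _ D).
        + intros E0; assert (K := Hspeed _ (Hseg dl T t Hi Hdl Ht)).
          destruct Hdl as [Hd|Hd]; rewrite Hd in E0, K; nra.
      - rewrite Rmult_0_r, Rplus_0_r; assert (K := Hspeed x0 Hx0).
        unfold dl; destruct (Rlt_dec _ _); nra. }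
    assert (K := length_descending (sqrt (2 * E)) (fun t => v (x0 + dl * t))
      (fun t => dl * Derive v (x0 + dl * t)) (fun t => dl * W (x0 + dl * t)) 0 T Hc HT).
    cbv beta in K; replace (W x0) with (W (x0 + dl * 0)) by (f_equal; ring).
    enough (dl * W (x0 + dl * T) - dl * W (x0 + dl * 0)
      <= exp (v (x0 + dl * 0)) / sqrt (2 * E)) by lra.
    apply K; intros t Ht; destruct (Hprof dl T Hi Hdl t Ht) as (D1 & _ & D3).
    split; [exact D1|split; [|exact D3]].
    assert (K1 := Hneg t Ht); assert (K2 := Hspeed _ (Hseg dl T t Hi Hdl Ht)).
    destruct Hdl as [Hd|Hd]; rewrite Hd in K1, K2 |- *; nra.
  - assert (HE0 : E <> 0) by apply H.
    set (k := sqrt (- 2 * E)).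
    assert (Hk : forall x, interval a b x -> exp (v x) <= k).
    { intros x Hx; destruct H as (_ & _ & _ & Hn); specialize (Hn ltac:(lra) x Hx).
      rewrite sqr_exp_double in Hn; unfold k; rewrite <- (Rabs_pos_eq (exp (v x)))
        by apply Rlt_le, exp_pos.
      apply abs_le_sqrt; lra. }
    (* the direction in which v^2 does not decrease at x0 *)
    set (dl := if Rle_dec 0 (v x0 * Derive v x0) then 1 else -1).
    assert (Hdl : dl = 1 \/ dl = -1) by (unfold dl; destruct (Rle_dec _ _); auto).
    apply (incomplete_of_finite_length a b v W dl x0 (k + k / (4 * Rabs (v x0))));
      try assumption.
    intros T HT Hi.
    assert (K := length_bounded_escape (fun t => v (x0 + dl * t))
      (fun t => dl * Derive v (x0 + dl * t)) (fun t => dl * W (x0 + dl * t)) T k HT).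
    cbv beta in K; rewrite !Rmult_0_r, Rplus_0_r in K.
    enough (dl * W (x0 + dl * T) - dl * W x0 <= k + k / (4 * Rabs (v x0))) by lra.
    apply K; [|exact Hne|].
    + intros t Ht; destruct (Hprof dl T Hi Hdl t Ht) as (D1 & D2 & D3).
      repeat (split; [assumption|]); now apply Hk, (Hseg dl T).
    + unfold dl; destruct (Rle_dec _ _); nra.
Qed.

(** * The trivial solution *)

Lemma flat_dist_ge (D : R -> Prop) (v : R -> R) p q eps :
  (forall x, v x = 0) ->
  Rbar_lt (riem_dist (strip D) (sigma_metric v) p q) (Finite eps) ->
  Rabs (fst q - fst p) < eps /\ Rabs (snd q - snd p) < eps.
Proof.
  intros Hv; replace v with (fun _ : R => 0)
    by (apply functional_extensionality; intros x; now rewrite Hv).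
  intros Hd; apply riem_dist_lt in Hd; destruct Hd as (a & b & Hab & Hl).
  assert (HP := Hab); destruct Hab as [Hp [H0 H1]]; rewrite <- H0, <- H1; simpl.
  split; apply Rle_lt_trans with (2 := Hl).
  - apply (path_length_ge D _ p q a b a (Derive a));
      [intros; apply continuous_const|exact HP|].
    intros t Ht; destruct (Hp t Ht) as (_ & Da & Ca & _ & _).
    split; [now apply Derive_correct|split; [exact Ca|]]; rewrite exp_0; nra.
  - apply (path_length_ge D _ p q a b b (Derive b));
      [intros; apply continuous_const|exact HP|].
    intros t Ht; destruct (Hp t Ht) as (_ & _ & _ & Db & Cb).
    split; [now apply Derive_correct|split; [exact Cb|]]; rewrite exp_0; nra.
Qed.

(** The straight segment has length sqrt (dx^2 + dy^2). *)
Lemma flat_dist_lt (D : R -> Prop) (v : R -> R) (p q : R * R) eps :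
  (forall x, D x) -> (forall x, v x = 0) ->
  Rabs (fst q - fst p) < eps / 2 -> Rabs (snd q - snd p) < eps / 2 ->
  Rbar_lt (riem_dist (strip D) (sigma_metric v) p q) (Finite eps).
Proof.
  intros HD Hv Hx Hy; apply riem_dist_lt.
  set (dx := fst q - fst p) in *; set (dy := snd q - snd p) in *.
  assert (Da : forall x d t, is_derive (fun t => x + t * d) t d).
  { intros x d t; auto_derive; [exact I|ring]. }
  assert (E : forall x d, Derive (fun t => x + t * d) = fun _ => d).
  { intros x d; apply functional_extensionality; intros t; now apply is_derive_unique. }
  exists (fun t => fst p + t * dx), (fun t => snd p + t * dy); split; [split|].
  - intros t _; rewrite !E; split; [apply HD|].
    repeat split; try apply continuous_const; eexists; apply Da.
  - unfold dx, dy; destruct p as [p1 p2], q as [q1 q2]; simpl; split; f_equal; ring.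
  - unfold path_length, sigma_metric; simpl; rewrite !E.
    rewrite (RInt_ext _ (fun _ => sqrt (dx * dx + dy * dy))).
    + rewrite RInt_const; unfold scal; simpl; unfold mult; simpl.
      rewrite Rminus_0_r, Rmult_1_l.
      assert (P := Rabs_pos dx); rewrite <- (sqrt_pow2 eps) by lra.
      apply sqrt_lt_1_alt; split; [nra|].
      apply Rabs_def2 in Hx, Hy; nra.
    + intros t _; rewrite Hv, Rmult_0_r, exp_0; f_equal; ring.
Qed.

Lemma flat_complete (D : R -> Prop) (v : R -> R) :
  (forall x, D x) -> (forall x, v x = 0) ->
  complete_surface (strip D) (sigma_metric v).
Proof.
  intros HD Hv s _ HC.
  destruct (Rcomplete.R_complete (fun n => fst (s n))) as [l1 H1].
  { intros eps Heps; destruct (HC eps Heps) as [M HM]; exists M; intros n m Hn Hm.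
    now apply (flat_dist_ge D v (s m) (s n) eps Hv), HM. }
  destruct (Rcomplete.R_complete (fun n => snd (s n))) as [l2 H2].
  { intros eps Heps; destruct (HC eps Heps) as [M HM]; exists M; intros n m Hn Hm.
    now apply (flat_dist_ge D v (s m) (s n) eps Hv), HM. }
  exists (l1, l2); split; [apply HD|]; intros eps Heps.
  destruct (H1 (eps / 2)) as [M1 K1]; [lra|]; destruct (H2 (eps / 2)) as [M2 K2]; [lra|].
  exists (max M1 M2); intros n Hn.
  apply flat_dist_lt; [exact HD|exact Hv| |]; simpl; rewrite Rabs_minus_sym;
    [apply K1; lia|apply K2; lia].
Qed.

Definition swap_timelike (p : R4) : R4 :=
  (fst (fst (fst p)), snd (fst (fst p)), snd p, snd (fst p)).

Lemma swap_timelike_isometry : H31_isometry swap_timelike.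
Proof.
  split.
  - unfold swap_timelike.
    assert (L1 : is_linear (fun p : R4 => fst (fst p))).
    { apply (is_linear_comp (fun p : R4 => fst p)); apply is_linear_fst. }
    repeat apply is_linear_prod.
    + apply (is_linear_comp (fun p : R4 => fst (fst p)) fst); [exact L1|apply is_linear_fst].
    + apply (is_linear_comp (fun p : R4 => fst (fst p)) snd); [exact L1|apply is_linear_snd].
    + apply is_linear_snd.
    + apply (is_linear_comp (fun p : R4 => fst p) snd); [apply is_linear_fst|apply is_linear_snd].
  - intros [[[u1 u2] u3] u4] [[[w1 w2] w3] w4]; unfold swap_timelike, form; simpl; ring.
Qed.

(** Here the energy is -1, hence k = sqrt 2, s = 1 and G(x) = - x. *)
Lemma phiE_trivial (v : R -> R) (x y : R) : (forall x, v x = 0) ->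
  phiE (-1) v x y = swap_timelike
    (/ sqrt 2 * sinh (- sqrt 2 * x), / sqrt 2 * sinh (sqrt 2 * y),
     / sqrt 2 * cosh (- sqrt 2 * x), / sqrt 2 * cosh (sqrt 2 * y)).
Proof.
  intros Hv; unfold phiE; destruct (Rlt_dec 0 (-1)); [lra|].
  assert (HG : Gint (-1) v x = - x).
  { assert (K : forall t, / (2 * -1 + exp (2 * v t)) = -1).
    { intros t; rewrite Hv, Rmult_0_r, exp_0; field. }
    unfold Gint; rewrite (RInt_ext _ (fun _ => -1)).
    - rewrite RInt_const; unfold scal; simpl; unfold mult; simpl; ring.
    - intros t _; apply K. }
  unfold phi_neg, swap_timelike; simpl; rewrite HG, Hv, Rmult_0_r, exp_0.
  replace (-2 * -1) with 2 by ring; replace (2 - 1) with 1 by ring; rewrite sqrt_1.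
  replace (sqrt 2 * - x) with (- sqrt 2 * x) by ring.
  f_equal; [f_equal; [f_equal|]|]; ring.
Qed.

Lemma trivial_hyperbolic_cylinder a b v E :
  (forall x, interval a b x -> energy v x = E) ->
  (forall x, interval a b x) -> (forall x, v x = 0) ->
  complete_surface (strip (interval a b)) (sigma_metric v)
  /\ exists A : R4 -> R4, H31_isometry A
       /\ forall p : R4,
            (exists x y : R, p = phiE E v x y)
            <-> (exists q : R4, hyperbolic_cylinder q /\ p = A q).
Proof.
  intros HE Hab Hv; split.
  - now apply flat_complete.
  - assert (HE1 : E = -1).
    { rewrite <- (HE 0 (Hab 0)); unfold energy.
      rewrite Hv, Rmult_0_r, cosh_0, (Derive_ext v (fun _ => 0)), Derive_const by exact Hv.
      ring. }
    subst E; exists swap_timelike; split; [apply swap_timelike_isometry|].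
    assert (P : 0 < sqrt 2) by (apply sqrt_lt_R0; lra).
    intros p; split.
    + intros (x & y & ->); rewrite phiE_trivial by exact Hv.
      eexists; split; [|reflexivity]; now exists (- sqrt 2 * x), (sqrt 2 * y).
    + intros (q & (c & d & ->) & ->); exists (- c / sqrt 2), (d / sqrt 2).
      rewrite phiE_trivial by exact Hv.
      replace (- sqrt 2 * (- c / sqrt 2)) with c by (field; lra).
      now replace (sqrt 2 * (d / sqrt 2)) with d by (field; lra).
Qed.

Theorem proposition1 (a b : Rbar) (v : R -> R) (E : R)
  (hab : Rbar_lt a b)
  (hv : sinh_gordon_solution (interval a b) v)
  (hE : forall x, interval a b x -> energy v x = E)
  (hE0 : E <> 0)
  (hneg : E < 0 -> forall x, interval a b x -> 2 * E + exp (2 * v x) < 0) :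
  (interval a b 0 ->
     isometric (strip (interval a b)) (sigma_metric v) (phiE E v)
     /\ exists N : R -> R -> R4,
          unit_normal (sign E) (strip (interval a b)) (phiE E v) N
          /\ maximal_wrt (strip (interval a b)) (phiE E v) N
          /\ (forall x y, strip (interval a b) x y ->
                hopf_coefficient (phiE E v) N x y = RtoC (1 / 2)))
  /\ (~ (forall x, interval a b x -> v x = 0) ->
        ~ complete_surface (strip (interval a b)) (sigma_metric v))
  /\ ((forall x, interval a b x) -> (forall x, v x = 0) ->
        complete_surface (strip (interval a b)) (sigma_metric v)
        /\ exists A : R4 -> R4, H31_isometry A
             /\ forall p : R4,
                  (exists x y : R, p = phiE E v x y)
                  <-> (exists q : R4, hyperbolic_cylinder q /\ p = A q)).
Proof.
  assert (H : admissible (interval a b) E v) by (repeat split; now try apply hv).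
  split; [|split].
  - now apply phiE_maximal_immersion.
  - now apply (nontrivial_incomplete a b v E).
  - now apply trivial_hyperbolic_cylinder.
Qed.
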